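(* Let $R$ be a commutative coherent ring and let $\mathcal{GP}$ be the class of Gorenstein projective $R$-modules. Assume that the class of $\mathcal{GP}$-pure injective $R$-modules coincides with the class of Gorenstein injective $R$-modules. Then the class of $\mathcal{GP}$-pure flat $R$-modules coincides with the class of Gorenstein flat $R$-modules.
   Context: All rings are commutative with identity. An $R$-module $M$ is Gorenstein projective if there is an exact complex $\mathbf{P}=\cdots\to P_1\to P_0\to P_{-1}\to\cdots$ of projective $R$-modules such that $\operatorname{Hom}_R(\mathbf{P},Q)$ is exact for every projective $R$-module $Q$ and $M\cong\operatorname{im}(P_0\to P_{-1})$. Dually, $M$ is Gorenstein injective if there is an exact complex $\mathbf{I}=\cdots\to I_1\to I_0\to I_{-1}\to\cdots$ of injective $R$-modules such that $\operatorname{Hom}_R(J,\mathbf{I})$ is exact for every injective $R$-module $J$ and $M\cong\operatorname{im}(I_0\to I_{-1})$. $M$ is Gorenstein flat if there is an exact complex $\mathbf{F}=\cdots\to F_1\to F_0\to F_{-1}\to\cdots$ of flat $R$-modules such that $J\otimes_R\mathbf{F}$ is exact for every injective $R$-module $J$ and $M\cong\operatorname{im}(F_0\to F_{-1})$. For a class $\mathscr{X}$ of $R$-modules, a short exact sequence $0\to A\to B\to C\to 0$ of $R$-modules is $\mathscr{X}$-pure exact if $\operatorname{Hom}_R(U,B)\to\operatorname{Hom}_R(U,C)$ is surjective for every $U\in\mathscr{X}$. An $R$-module $M$ is $\mathscr{X}$-pure injective (respectively $\mathscr{X}$-pure flat) if the functor $\operatorname{Hom}_R(-,M)$ (respectively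 $M\otimes_R-$) leaves every $\mathscr{X}$-pure exact sequence exact. *)

(* Defs.v *)
From HB Require Import structures.
From mathcomp Require Import all_boot all_algebra.
From mathcomp Require Import boolp.

Set Implicit Arguments.
Unset Strict Implicit.
Unset Printing Implicit Defensive.

Import GRing.Theory.
Local Open Scope ring_scope.
Local Open Scope quotient_scope.

Definition surjective (A B : Type) (f : A -> B) : Prop :=
  forall y, exists x, f x = y.

Definition exact (A B C : zmodType) (f : A -> B) (g : B -> C) : Prop :=
  forall y, g y = 0 <-> exists x, f x = y.

Definition short_exact (A B C : zmodType) (f : A -> B) (g : B -> C) : Prop :=
  [/\ injective f, exact f g & surjective g].

(* An alias of [{linear U -> V}], so that the instances below cannot clash with
   instances declared on [{linear U -> V}] in other libraries. *)
Definition hom (R : comPzRingType) (U V : lmodType R) : Type := {linear U -> V}.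

Section Hom.
Variables (R : comPzRingType) (U V : lmodType R).
Implicit Types f g h : hom U V.

HB.instance Definition _ := gen_eqMixin (hom U V).
HB.instance Definition _ := gen_choiceMixin (hom U V).

Lemma homP f g : f =1 g <-> f = g.
Proof.
split=> [|-> //]; case: f => f [[fD] [fZ]]; case: g => g [[gD] [gZ]] /= /funext fg.
case: _ / fg gD gZ => gD gZ.
by rewrite (Prop_irrelevance fD gD) (Prop_irrelevance fZ gZ).
Qed.

Definition hom_zero : hom U V := GRing.Linear.clone _ _ _ _ (\0 : U -> V) _.
Definition hom_opp f : hom U V := GRing.Linear.clone _ _ _ _ (\- f) _.
Definition hom_add f g : hom U V := GRing.Linear.clone _ _ _ _ (f \+ g) _.

Fact hom_addA : associative hom_add.
Proof. by move=> f g h; apply/homP => x; apply: addrA. Qed.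
Fact hom_addC : commutative hom_add.
Proof. by move=> f g; apply/homP => x; apply: addrC. Qed.
Fact hom_add0 : left_id hom_zero hom_add.
Proof. by move=> f; apply/homP => x; apply: add0r. Qed.
Fact hom_addN : left_inverse hom_zero hom_opp hom_add.
Proof. by move=> f; apply/homP => x; apply: addNr. Qed.

HB.instance Definition _ :=
  GRing.isZmodule.Build (hom U V) hom_addA hom_addC hom_add0 hom_addN.

Lemma hom0E x : (0 : hom U V) x = 0. Proof. by []. Qed.
Lemma homDE f g x : (f + g) x = f x + g x. Proof. by []. Qed.
Lemma homNE f x : (- f) x = - f x. Proof. by []. Qed.
End Hom.

Definition hom_pre (R : comPzRingType) (A B : lmodType R) (f : {linear A -> B})
  (V : lmodType R) (h : hom B V) : hom A V :=
  GRing.Linear.clone _ _ _ _ (h \o f) _.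

Definition hom_post (R : comPzRingType) (U : lmodType R) (A B : lmodType R)
  (g : {linear A -> B}) (h : hom U A) : hom U B :=
  GRing.Linear.clone _ _ _ _ (g \o h) _.

Arguments hom_pre {R A B} f V h.
Arguments hom_post {R} U {A B} g h.

(* Elements are finite formal sums of pairs, i.e. words over M * N, modulo the
   congruence generated by commutativity and by the bilinearity relations.
   No formal inverses are needed, since (- m, n) is inverse to (m, n): their
   sum is (0, n), which [tens_zero] identifies with the empty word. *)
Inductive tens_rel (R : comPzRingType) (M N : lmodType R) :
    seq (M * N) -> seq (M * N) -> Prop :=
  | tens_refl s : tens_rel s s
  | tens_sym s t : tens_rel s t -> tens_rel t s
  | tens_trans t s u : tens_rel s t -> tens_rel t u -> tens_rel s u
  | tens_cat s s' t t' :
      tens_rel s s' -> tens_rel t t' -> tens_rel (s ++ t) (s' ++ t')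
  | tens_catC s t : tens_rel (s ++ t) (t ++ s)
  | tens_addl m m' n : tens_rel [:: (m + m', n)] [:: (m, n); (m', n)]
  | tens_addr m n n' : tens_rel [:: (m, n + n')] [:: (m, n); (m, n')]
  | tens_scale a m n : tens_rel [:: (a *: m, n)] [:: (m, a *: n)]
  | tens_zero n : tens_rel [:: (0, n)] [::].

Section Tensor.
Variables (R : comPzRingType) (M N : lmodType R).
Implicit Types (s t : seq (M * N)) (m : M) (n : N).

Definition tens_eqv s t : bool := `[< tens_rel s t >].

Fact tens_eqv_refl : reflexive tens_eqv.
Proof. by move=> s; apply/asboolP; apply: tens_refl. Qed.
Fact tens_eqv_sym : symmetric tens_eqv.
Proof. by move=> s t; apply/asboolP/asboolP => /tens_sym. Qed.
Fact tens_eqv_trans : transitive tens_eqv.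
Proof.
by move=> t s u /asboolP st /asboolP tu; apply/asboolP; apply: tens_trans tu.
Qed.
Canonical tens_equiv : equiv_rel (seq (M * N)) :=
  EquivRel tens_eqv tens_eqv_refl tens_eqv_sym tens_eqv_trans.

Definition tensor : Type := {eq_quot tens_equiv}.
HB.instance Definition _ := Choice.on tensor.
HB.instance Definition _ := EqQuotient.on tensor.

Lemma tensorP s t : (\pi_tensor s = \pi_tensor t) <-> tens_rel s t.
Proof. by split=> [/eqmodP/asboolP|st]; last exact/eqmodP/asboolP. Qed.

Lemma tensorW (P : tensor -> Prop) :
  (forall s, P (\pi_tensor s)) -> forall x, P x.
Proof. by move=> Ps x; rewrite -[x]reprK. Qed.

Lemma tensor_repr s : tens_rel (repr (\pi_tensor s)) s.
Proof. by apply/tensorP; rewrite reprK. Qed.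

Definition tens_zscale (a : R) s := [seq (a *: p.1, p.2) | p <- s].

Lemma tens_zscale_rel a s t :
  tens_rel s t -> tens_rel (tens_zscale a s) (tens_zscale a t).
Proof.
elim=> {s t} /=.
- by move=> s; apply: tens_refl.
- by move=> s t _; apply: tens_sym.
- by move=> t s u _ st _; apply: tens_trans.
- by move=> s s' t t' _ ss _ tt; rewrite /tens_zscale !map_cat; apply: tens_cat.
- by move=> s t; rewrite /tens_zscale !map_cat; apply: tens_catC.
- by move=> m m' n; rewrite scalerDr; apply: tens_addl.
- by move=> m n n'; apply: tens_addr.
- by move=> b m n; rewrite scalerA mulrC -scalerA; apply: tens_scale.
- by move=> n; rewrite scaler0; apply: tens_zero.
Qed.

Definition tensor_zero : tensor := \pi_tensor [::].
Definition tensor_add (x y : tensor) : tensor := \pi_tensor (repr x ++ repr y).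
Definition tensor_scale (a : R) (x : tensor) : tensor :=
  \pi_tensor (tens_zscale a (repr x)).
Definition tensor_opp (x : tensor) : tensor := tensor_scale (-1) x.

Lemma tensor_addE s t :
  tensor_add (\pi_tensor s) (\pi_tensor t) = \pi_tensor (s ++ t).
Proof. by apply/tensorP; apply: tens_cat; apply: tensor_repr. Qed.

Lemma tensor_scaleE a s :
  tensor_scale a (\pi_tensor s) = \pi_tensor (tens_zscale a s).
Proof. by apply/tensorP/tens_zscale_rel/tensor_repr. Qed.

Fact tensor_addA : associative tensor_add.
Proof.
by elim/tensorW=> s; elim/tensorW=> t; elim/tensorW=> u; rewrite !tensor_addE catA.
Qed.
Fact tensor_addC : commutative tensor_add.
Proof.
elim/tensorW=> s; elim/tensorW=> t; rewrite !tensor_addE.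
by apply/tensorP; apply: tens_catC.
Qed.
Fact tensor_add0 : left_id tensor_zero tensor_add.
Proof. by elim/tensorW=> s; rewrite tensor_addE. Qed.

Fact tensor_scaleDl a b x :
  tensor_scale (a + b) x = tensor_add (tensor_scale a x) (tensor_scale b x).
Proof.
elim/tensorW: x => s; rewrite !tensor_scaleE tensor_addE; apply/tensorP.
elim: s => [|[m n] s IHs] /=; first exact: tens_refl.
apply: (@tens_trans _ _ _
  ([:: (a *: m, n); (b *: m, n)] ++ (tens_zscale a s ++ tens_zscale b s))).
  rewrite -cat1s; apply: tens_cat IHs.
  by rewrite scalerDl; apply: tens_addl.
rewrite -[X in tens_rel X]/([:: (a *: m, n)] ++
  (([:: (b *: m, n)] ++ tens_zscale a s) ++ tens_zscale b s)).
rewrite -[X in tens_rel _ X]/([:: (a *: m, n)] ++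
  (tens_zscale a s ++ [:: (b *: m, n)] ++ tens_zscale b s)).
apply: tens_cat; first exact: tens_refl.
rewrite [X in tens_rel _ X]catA; apply: tens_cat (tens_refl _).
exact: tens_catC.
Qed.

Fact tensor_scale0 x : tensor_scale 0 x = tensor_zero.
Proof.
elim/tensorW: x => s; rewrite tensor_scaleE; apply/tensorP.
elim: s => [|[m n] s IHs] /=; first exact: tens_refl.
rewrite -cat1s -[[::]]/([::] ++ [::]); apply: tens_cat IHs.
by rewrite scale0r; apply: tens_zero.
Qed.

Fact tensor_scale1 : left_id 1 tensor_scale.
Proof.
elim/tensorW=> s; rewrite tensor_scaleE; congr (\pi_tensor _).
by rewrite -[RHS]map_id; apply: eq_map => -[m n] /=; rewrite scale1r.
Qed.

Fact tensor_addN : left_inverse tensor_zero tensor_opp tensor_add.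
Proof.
move=> x; rewrite -{2}[x]tensor_scale1 -tensor_scaleDl addNr.
exact: tensor_scale0.
Qed.

HB.instance Definition _ :=
  GRing.isZmodule.Build tensor tensor_addA tensor_addC tensor_add0 tensor_addN.

Lemma tensorDE s t :
  \pi_tensor s + \pi_tensor t = \pi_tensor (s ++ t) :> tensor.
Proof. exact: tensor_addE. Qed.

Fact tensor_scaleA a b x :
  tensor_scale a (tensor_scale b x) = tensor_scale (a * b) x.
Proof.
elim/tensorW: x => s; rewrite !tensor_scaleE; congr (\pi_tensor _).
by rewrite /tens_zscale -map_comp; apply: eq_map => p /=; rewrite scalerA.
Qed.
Fact tensor_scaleDr : right_distributive tensor_scale +%R.
Proof.
move=> a; elim/tensorW=> s; elim/tensorW=> t.
by rewrite tensorDE !tensor_scaleE tensorDE /tens_zscale map_cat.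
Qed.

HB.instance Definition _ := GRing.Zmodule_isLmodule.Build R tensor
  tensor_scaleA tensor_scale1 tensor_scaleDr
  (fun x a b => tensor_scaleDl a b x).

Lemma tensorZE a s :
  a *: \pi_tensor s = \pi_tensor (tens_zscale a s) :> tensor.
Proof. exact: tensor_scaleE. Qed.

Definition tpure m n : tensor := \pi_tensor [:: (m, n)].

Lemma tensor_sum s : \pi_tensor s = \sum_(p <- s) tpure p.1 p.2.
Proof.
elim: s => [|[m n] s IHs]; first by rewrite big_nil.
by rewrite big_cons -IHs -cat1s -tensorDE.
Qed.

Lemma tpure_scale a m n : tpure (a *: m) n = tpure m (a *: n).
Proof. by apply/tensorP/tens_scale. Qed.

Lemma tpure_linearl n : linear (tpure^~ n).
Proof.
by move=> a m m'; rewrite /tpure tensorZE tensorDE; apply/tensorP/tens_addl.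
Qed.

Lemma tpure_linearr m : linear (tpure m).
Proof.
move=> a n n'; have -> : a *: tpure m n = tpure m (a *: n).
  by rewrite -tpure_scale /tpure tensorZE.
by rewrite /tpure tensorDE; apply/tensorP/tens_addr.
Qed.

Lemma tens_rel_sum (L : zmodType) (b : M -> N -> L) :
    (forall m m' n, b (m + m') n = b m n + b m' n) ->
    (forall m n n', b m (n + n') = b m n + b m n') ->
    (forall a m n, b (a *: m) n = b m (a *: n)) ->
  forall s t, tens_rel s t ->
  \sum_(p <- s) b p.1 p.2 = \sum_(p <- t) b p.1 p.2.
Proof.
move=> bDl bDr bZ s t; elim=> {s t} //=.
- by move=> t s u _ -> _ ->.
- by move=> s s' t t' _ ss _ tt; rewrite !big_cat /= ss tt.
- by move=> s t; rewrite !big_cat /= addrC.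
- by move=> m m' n; rewrite !big_cons !big_nil !addr0 /= bDl.
- by move=> m n n'; rewrite !big_cons !big_nil !addr0 /= bDr.
- by move=> a m n; rewrite !big_cons !big_nil !addr0 /= bZ.
- move=> n; rewrite big_cons !big_nil addr0 /=.
  by apply: (addrI (b 0 n)); rewrite -bDl !addr0.
Qed.

Theorem tensor_universal (L : lmodType R) (b : M -> N -> L) :
    (forall n, linear (b^~ n)) -> (forall m, linear (b m)) ->
  exists! g : hom tensor L, forall m n, g (tpure m n) = b m n.
Proof.
move=> bl br.
have bDl m m' n : b (m + m') n = b m n + b m' n.
  by have := bl n 1 m m'; rewrite !scale1r.
have bDr m n n' : b m (n + n') = b m n + b m n'.
  by have := br m 1 n n'; rewrite !scale1r.
have b0l n : b 0 n = 0 by apply: (addrI (b 0 n)); rewrite -bDl !addr0.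
have b0r m : b m 0 = 0 by apply: (addrI (b m 0)); rewrite -bDr !addr0.
have bZl a m n : b (a *: m) n = a *: b m n.
  by have := bl n a m 0; rewrite b0l !addr0.
have bZr a m n : b m (a *: n) = a *: b m n.
  by have := br m a n 0; rewrite b0r !addr0.
have bZ a m n : b (a *: m) n = b m (a *: n) by rewrite bZl bZr.
pose g (x : tensor) : L := \sum_(p <- repr x) b p.1 p.2.
have gE s : g (\pi_tensor s) = \sum_(p <- s) b p.1 p.2.
  exact/(tens_rel_sum bDl bDr bZ)/tensor_repr.
have glin : linear g.
  move=> a; elim/tensorW=> s; elim/tensorW=> t.
  rewrite tensorZE tensorDE.
  rewrite !gE big_cat big_map /= scaler_sumr; congr (_ + _).
  by apply: eq_bigr => p _; rewrite bZl.
pose gL := GRing.isLinear.Build R tensor L *:%R g glin.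
pose G : {linear tensor -> L} := HB.pack g gL.
exists G; split=> [m n|h hb]; first by rewrite /= gE big_seq1.
apply/homP; elim/tensorW=> s; rewrite /= gE tensor_sum raddf_sum.
by apply: eq_bigr => p _; apply/esym/hb.
Qed.
End Tensor.

Section TensorMap.
Variables (R : comPzRingType) (M A B : lmodType R) (f : {linear A -> B}).

Definition tens_map (s : seq (M * A)) : seq (M * B) :=
  [seq (p.1, f p.2) | p <- s].

Definition tensor_map (x : tensor M A) : tensor M B :=
  \pi_(tensor M B) (tens_map (repr x)).

Lemma tens_map_rel s t : tens_rel s t -> tens_rel (tens_map s) (tens_map t).
Proof.
elim=> {s t} /=.
- by move=> s; apply: tens_refl.
- by move=> s t _; apply: tens_sym.
- by move=> t s u _ st _; apply: tens_trans.
- by move=> s s' t t' _ ss _ tt; rewrite /tens_map !map_cat; apply: tens_cat.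
- by move=> s t; rewrite /tens_map !map_cat; apply: tens_catC.
- by move=> m m' n; apply: tens_addl.
- by move=> m n n'; rewrite linearD; apply: tens_addr.
- by move=> a m n; rewrite linearZ; apply: tens_scale.
- by move=> n; apply: tens_zero.
Qed.

Lemma tensor_mapE s :
  tensor_map (\pi_(tensor M A) s) = \pi_(tensor M B) (tens_map s).
Proof. by apply/tensorP/tens_map_rel/tensor_repr. Qed.

Lemma tensor_map_tpure m a : tensor_map (tpure m a) = tpure m (f a).
Proof. exact: tensor_mapE. Qed.

Fact tensor_map_linear : linear tensor_map.
Proof.
move=> a; elim/tensorW=> s; elim/tensorW=> t.
rewrite tensorZE tensorDE !tensor_mapE tensorZE tensorDE.
congr (\pi_(tensor M B) _); rewrite /tens_map /tens_zscale map_cat -!map_comp.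
by [].
Qed.
HB.instance Definition _ := GRing.isLinear.Build R (tensor M A) (tensor M B)
  *:%R tensor_map tensor_map_linear.
End TensorMap.
Arguments tensor_map {R} M {A B} f x.

Section Modules.
Variable R : comPzRingType.
Implicit Types M U Q J : lmodType R.

Definition projective M : Prop :=
  forall (A B : lmodType R) (g : {linear A -> B}),
    surjective g -> surjective (hom_post M g).

Definition injective_module M : Prop :=
  forall (A B : lmodType R) (f : {linear A -> B}),
    injective f -> surjective (hom_pre f M).

Definition flat M : Prop :=
  forall (A B C : lmodType R) (f : {linear A -> B}) (g : {linear B -> C}),
    short_exact f g -> short_exact (tensor_map M f) (tensor_map M g).

Definition finitely_generated M : Prop :=
  exists n (g : {linear 'rV[R]_n -> M}), surjective g.

Definition finitely_presented M : Prop :=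
  exists m n (f : {linear 'rV[R]_m -> 'rV[R]_n}) (g : {linear 'rV[R]_n -> M}),
    exact f g /\ surjective g.

(* Ideals of R are represented by modules with an injective linear map to R. *)
Definition coherent : Prop :=
  forall (I : lmodType R) (j : {linear I -> R^o}),
    injective j -> finitely_generated I -> finitely_presented I.

(* With this indexing, ranging over all i : int, the differential
   C_(i + 1) -> C_i needs no transport along an equality of indices. *)
Record complex : Type := Complex {
  cx_mod :> int -> lmodType R;
  cx_diff : forall i : int, {linear cx_mod (i + 1) -> cx_mod i}
}.

Definition exact_complex (C : complex) : Prop :=
  forall i : int, exact (cx_diff C (i + 1)) (cx_diff C i).

Definition exact_hom_from (C : complex) Q : Prop :=
  forall i : int, exact (hom_pre (cx_diff C i) Q) (hom_pre (cx_diff C (i + 1)) Q).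

Definition exact_hom_to J (C : complex) : Prop :=
  forall i : int, exact (hom_post J (cx_diff C (i + 1))) (hom_post J (cx_diff C i)).

Definition exact_tensor J (C : complex) : Prop :=
  forall i : int,
    exact (tensor_map J (cx_diff C (i + 1))) (tensor_map J (cx_diff C i)).

(* An isomorphism M -> im f, given as its composite with im f -> B. *)
Definition iso_image M (A B : lmodType R) (f : {linear A -> B}) : Prop :=
  exists e : {linear M -> B},
    injective e /\ forall y, (exists x, e x = y) <-> (exists x, f x = y).

Definition is_syzygy M (C : complex) : Prop :=
  iso_image M (cx_diff C (-1) : {linear C 0 -> C (-1)}).

Definition Gorenstein_projective M : Prop :=
  exists P : complex, [/\ forall i, projective (P i), exact_complex P,
    forall Q, projective Q -> exact_hom_from P Q & is_syzygy M P].

Definition Gorenstein_injective M : Prop :=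
  exists I : complex, [/\ forall i, injective_module (I i), exact_complex I,
    forall J, injective_module J -> exact_hom_to J I & is_syzygy M I].

Definition Gorenstein_flat M : Prop :=
  exists F : complex, [/\ forall i, flat (F i), exact_complex F,
    forall J, injective_module J -> exact_tensor J F & is_syzygy M F].

Definition pure_exact (X : lmodType R -> Prop) (A B C : lmodType R)
    (f : {linear A -> B}) (g : {linear B -> C}) : Prop :=
  short_exact f g /\ forall U, X U -> surjective (hom_post U g).

Definition pure_injective (X : lmodType R -> Prop) M : Prop :=
  forall (A B C : lmodType R) (f : {linear A -> B}) (g : {linear B -> C}),
    pure_exact X f g -> short_exact (hom_pre g M) (hom_pre f M).

Definition pure_flat (X : lmodType R -> Prop) M : Prop :=
  forall (A B C : lmodType R) (f : {linear A -> B}) (g : {linear B -> C}),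
    pure_exact X f g -> short_exact (tensor_map M f) (tensor_map M g).

End Modules.

(* Main.v *)
(** Let E be the injective cogenerator Hom_Z(R, Q/Z) and M^+ = Hom_R(M, E). By
    the tensor-hom adjunction M is X-pure flat iff M^+ is X-pure injective, so
    the theorem reduces to: M is Gorenstein flat iff M^+ is Gorenstein
    injective. Dualizing a complete flat resolution gives one direction. For the
    other, the class of all M with M^+ Gorenstein injective is extended by flat
    modules on both sides: downwards by a free cover of M, upwards by
    M -> M^++ -> I^+, where I -> M^+ is an injective cover with Gorenstein
    injective kernel and I^+ is flat by coherence. In both cases Schanuel's
    trick exhibits the dual of the new module as a direct summand of a
    Gorenstein injective one, and by the hypothesis Gorenstein injective modules,
    being the pure injective ones, are closed under direct summands. *)

From HB Require Import structures.
From mathcomp Require Import all_boot all_algebra.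
From mathcomp Require Import boolp classical_sets.
Require Import Defs.

Set Implicit Arguments.
Unset Strict Implicit.
Unset Printing Implicit Defensive.

Import GRing.Theory Num.Theory.
Local Open Scope ring_scope.
Local Open Scope quotient_scope.

(** * Submodules and quotient modules *)

Definition mk_linear (R : pzRingType) (U V : lmodType R) (f : U -> V)
    (fl : linear f) : {linear U -> V} :=
  HB.pack f (GRing.isLinear.Build R U V *:%R f fl).

(** A [Prop]-valued predicate, so that kernels, images and graphs of partial maps can be given
    directly; [sub_pred] makes it boolean classically. *)
Record submodule (R : pzRingType) (U : lmodType R) := Submodule {
  in_sub :> U -> Prop;
  in_sub0 : in_sub 0;
  in_subP : forall a x y, in_sub x -> in_sub y -> in_sub (a *: x + y)
}.

Section Submodule.
Variables (R : pzRingType) (U : lmodType R) (S : submodule U).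

Lemma in_subD x y : S x -> S y -> S (x + y).
Proof. by move=> Sx Sy; rewrite -[x]scale1r; apply: in_subP. Qed.
Lemma in_subZ a x : S x -> S (a *: x).
Proof. by move=> Sx; rewrite -[a *: x]addr0; apply/in_subP/in_sub0. Qed.
Lemma in_subN x : S x -> S (- x).
Proof. by rewrite -scaleN1r; apply: in_subZ. Qed.
Lemma in_subB x y : S x -> S y -> S (x - y).
Proof. by move=> Sx /in_subN; apply: in_subD. Qed.

Definition sub_pred : {pred U} := fun x => `[< S x >].

Fact sub_pred_closed : subsemimod_closed sub_pred.
Proof.
split; first split; first exact/asboolP/in_sub0.
- by move=> x y /asboolP Sx /asboolP Sy; apply/asboolP/in_subD.
- by move=> a x /asboolP Sx; apply/asboolP/in_subZ.
Qed.
HB.instance Definition _ := GRing.isSubmodClosed.Build R U sub_pred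
  sub_pred_closed.

Definition subm : Type := {x : U | x \in sub_pred}.
HB.instance Definition _ := SubChoice.on subm.
HB.instance Definition _ := [SubChoice_isSubLmodule of subm by <:].

Definition sub_incl : {linear subm -> U} := val.

Lemma sub_incl_inj : injective sub_incl. Proof. exact: val_inj. Qed.

Lemma sub_inclP x : (exists y, sub_incl y = x) <-> S x.
Proof.
split=> [[y <-]|Sx]; first exact/asboolP/(valP y).
by exists (Sub x (asboolT Sx) : subm); apply: SubK.
Qed.

Definition quot_eqv (x y : U) : bool := `[< S (x - y) >].
Fact quot_eqv_refl : reflexive quot_eqv.
Proof. by move=> x; apply/asboolP; rewrite subrr; apply: in_sub0. Qed.
Fact quot_eqv_sym : symmetric quot_eqv.
Proof. by move=> x y; apply/asboolP/asboolP => /in_subN; rewrite opprB. Qed.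
Fact quot_eqv_trans : transitive quot_eqv.
Proof.
move=> y x z /asboolP Sxy /asboolP Syz; apply/asboolP.
by rewrite -[x](subrK y) -addrA; apply: in_subD.
Qed.
Canonical quot_equiv : equiv_rel U :=
  EquivRel quot_eqv quot_eqv_refl quot_eqv_sym quot_eqv_trans.

Definition quot : Type := {eq_quot quot_equiv}.
HB.instance Definition _ := Choice.on quot.
HB.instance Definition _ := EqQuotient.on quot.

Lemma quotP x y : \pi_quot x = \pi_quot y <-> S (x - y).
Proof. by split=> [/eqmodP/asboolP|Sxy]; last exact/eqmodP/asboolP. Qed.

Lemma quot_repr x : S (repr (\pi_quot x) - x).
Proof. by apply/quotP; rewrite reprK. Qed.

Definition quot_add (x y : quot) : quot := \pi_quot (repr x + repr y).
Definition quot_scale (a : R) (x : quot) : quot := \pi_quot (a *: repr x).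

Lemma quot_addE x y : quot_add (\pi_quot x) (\pi_quot y) = \pi_quot (x + y).
Proof.
by apply/quotP; rewrite opprD addrACA; apply: in_subD; apply: quot_repr.
Qed.
Lemma quot_scaleE a x : quot_scale a (\pi_quot x) = \pi_quot (a *: x).
Proof. by apply/quotP; rewrite -scalerBr; apply/in_subZ/quot_repr. Qed.

Lemma quotW (P : quot -> Prop) : (forall x, P (\pi_quot x)) -> forall x, P x.
Proof. by move=> Px x; rewrite -[x]reprK. Qed.

Fact quot_addA : associative quot_add.
Proof.
elim/quotW=> x; elim/quotW=> y; elim/quotW=> z.
by rewrite !quot_addE addrA.
Qed.
Fact quot_addC : commutative quot_add.
Proof. by elim/quotW=> x; elim/quotW=> y; rewrite !quot_addE addrC. Qed.
Fact quot_add0 : left_id (\pi_quot 0) quot_add.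
Proof. by elim/quotW=> x; rewrite quot_addE add0r. Qed.
Fact quot_addN : left_inverse (\pi_quot 0) (quot_scale (-1)) quot_add.
Proof. by elim/quotW=> x; rewrite quot_scaleE quot_addE scaleN1r addNr. Qed.
HB.instance Definition _ :=
  GRing.isZmodule.Build quot quot_addA quot_addC quot_add0 quot_addN.

Lemma quotDE x y : \pi_quot x + \pi_quot y = \pi_quot (x + y) :> quot.
Proof. exact: quot_addE. Qed.

Fact quot_scaleA a b x : quot_scale a (quot_scale b x) = quot_scale (a * b) x.
Proof. by elim/quotW: x => x; rewrite !quot_scaleE scalerA. Qed.
Fact quot_scale1 : left_id 1 quot_scale.
Proof. by elim/quotW=> x; rewrite quot_scaleE scale1r. Qed.
Fact quot_scaleDr : right_distributive quot_scale +%R.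
Proof.
move=> a; elim/quotW=> x; elim/quotW=> y.
by rewrite quotDE !quot_scaleE quotDE scalerDr.
Qed.
Fact quot_scaleDl x : {morph quot_scale^~ x : a b / a + b}.
Proof.
by elim/quotW: x => x a b; rewrite !quot_scaleE quotDE scalerDl.
Qed.
HB.instance Definition _ := GRing.Zmodule_isLmodule.Build R quot
  quot_scaleA quot_scale1 quot_scaleDr quot_scaleDl.

Lemma quotZE a x : a *: \pi_quot x = \pi_quot (a *: x) :> quot.
Proof. exact: quot_scaleE. Qed.

Fact quot_proj_linear : linear (\pi_quot : U -> quot).
Proof. by move=> a x y; rewrite quotZE quotDE. Qed.
Definition quot_proj : {linear U -> quot} := mk_linear quot_proj_linear.

Lemma quot_proj_surj : surjective quot_proj.
Proof. by move=> x; exists (repr x); apply: reprK. Qed.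

Lemma quot_proj0 x : quot_proj x = 0 <-> S x.
Proof. by rewrite -{2}[x]subr0; apply: quotP. Qed.
End Submodule.

(** * Kernels, images and factorization of linear maps *)

Section FactorMaps.
Variable R : pzRingType.
Implicit Types A B C D : lmodType R.

Definition ker_sub A B (f : {linear A -> B}) : submodule A.
Proof.
exists (fun x => f x = 0); first exact: linear0.
by move=> a x y fx fy; rewrite linearP fx fy scaler0 addr0.
Defined.

Definition im_sub A B (f : {linear A -> B}) : submodule B.
Proof.
exists (fun y => exists x, f x = y); first by exists 0; apply: linear0.
by move=> a _ _ [x <-] [y <-]; exists (a *: x + y); rewrite linearP.
Defined.

Lemma inj_linear A B (f : {linear A -> B}) :
  (forall x, f x = 0 -> x = 0) -> injective f.
Proof.
move=> f0 x y fxy; apply/subr0_eq/f0.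
by rewrite linearB /= fxy subrr.
Qed.

(** [h] is constant on the fibres of [g], so composing it with a section of [g] given by choice is
    linear, even though the section itself need not be. *)
Lemma factor_surj B C D (g : {linear B -> C}) (h : {linear B -> D}) :
    surjective g -> (forall y, g y = 0 -> h y = 0) ->
  exists k : {linear C -> D}, forall y, k (g y) = h y.
Proof.
move=> /choice[s gs] gh.
have hE y y' : g y = g y' -> h y = h y'.
  move=> gyy; apply/subr0_eq; rewrite -linearB; apply: gh.
  by rewrite linearB /= gyy subrr.
have kl : linear (h \o s).
  move=> a x y /=; rewrite -linearP; apply: hE.
  by rewrite linearP !gs.
by exists (mk_linear kl) => y; apply: hE; rewrite gs.
Qed.

Lemma factor_inj A B D (f : {linear A -> B}) (h : {linear D -> B}) :
    injective f -> (forall d, exists a, f a = h d) ->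
  exists k : {linear D -> A}, forall d, f (k d) = h d.
Proof.
move=> fi /choice[k fk].
have kl : linear k by move=> a x y; apply: fi; rewrite linearP !fk linearP.
by exists (mk_linear kl).
Qed.

Lemma short_exact_coker A B (f : {linear A -> B}) :
  injective f -> short_exact f (quot_proj (im_sub f)).
Proof.
by move=> fi; split=> [//|y|]; [apply: quot_proj0 | apply: quot_proj_surj].
Qed.

Lemma short_exact_ker B C (g : {linear B -> C}) :
  surjective g -> short_exact (sub_incl (ker_sub g)) g.
Proof.
move=> gs; split=> [|y|//]; first exact: sub_incl_inj.
by apply: iff_sym; apply: (sub_inclP (ker_sub g)).
Qed.
End FactorMaps.

(** * Free modules *)

Section FreeModule.
Variables (R : comPzRingType) (X : choiceType).
Implicit Types s t : seq (R * X).

Definition wsum (L : lmodType R) (phi : X -> L) s : L :=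
  \sum_(p <- s) p.1 *: phi p.2.

Lemma wsum_cat (L : lmodType R) (phi : X -> L) s t :
  wsum phi (s ++ t) = wsum phi s + wsum phi t.
Proof. exact: big_cat. Qed.

Definition wscale (a : R) s := [seq (a * p.1, p.2) | p <- s].

Lemma wsum_scale (L : lmodType R) (phi : X -> L) a s :
  wsum phi (wscale a s) = a *: wsum phi s.
Proof.
rewrite /wsum big_map scaler_sumr.
by apply: eq_bigr => p _; rewrite scalerA.
Qed.

(* Words are identified when every map from [X] to a module gives them the same
   value, so that the universal property holds by construction. *)
Definition free_eqv s t : bool :=
  `[< forall (L : lmodType R) (phi : X -> L), wsum phi s = wsum phi t >].
Fact free_eqv_refl : reflexive free_eqv.
Proof. by move=> s; apply/asboolP. Qed.
Fact free_eqv_sym : symmetric free_eqv.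
Proof. by move=> s t; apply/asboolP/asboolP => st L phi; rewrite st. Qed.
Fact free_eqv_trans : transitive free_eqv.
Proof.
by move=> t s u /asboolP st /asboolP tu; apply/asboolP => L phi; rewrite st.
Qed.
Canonical free_equiv : equiv_rel (seq (R * X)) :=
  EquivRel free_eqv free_eqv_refl free_eqv_sym free_eqv_trans.

Definition free : Type := {eq_quot free_equiv}.
HB.instance Definition _ := Choice.on free.
HB.instance Definition _ := EqQuotient.on free.

Definition free_val (L : lmodType R) (phi : X -> L) (x : free) : L :=
  wsum phi (repr x).

Lemma free_valE (L : lmodType R) (phi : X -> L) s :
  free_val phi (\pi_free s) = wsum phi s.
Proof.
have /eqmodP/asboolP : \pi_free (repr (\pi_free s)) = \pi_free s by rewrite reprK.
exact.
Qed.

Lemma freeP (x y : free) :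
  (forall (L : lmodType R) (phi : X -> L), free_val phi x = free_val phi y) ->
  x = y.
Proof. by move=> xy; rewrite -[x]reprK -[y]reprK; apply/eqmodP/asboolP. Qed.

Definition free_add (x y : free) : free := \pi_free (repr x ++ repr y).
Definition free_scale a (x : free) : free := \pi_free (wscale a (repr x)).

Lemma free_val_add (L : lmodType R) (phi : X -> L) x y :
  free_val phi (free_add x y) = free_val phi x + free_val phi y.
Proof. by rewrite free_valE wsum_cat. Qed.
Lemma free_val_scale (L : lmodType R) (phi : X -> L) a x :
  free_val phi (free_scale a x) = a *: free_val phi x.
Proof. by rewrite free_valE wsum_scale. Qed.
Lemma free_val0 (L : lmodType R) (phi : X -> L) :
  free_val phi (\pi_free [::]) = 0.
Proof. by rewrite free_valE /wsum big_nil. Qed.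

Let free_valS := (free_val_add, free_val_scale, free_val0).

Fact free_addA : associative free_add.
Proof. by move=> x y z; apply: freeP => L phi; rewrite !free_valS addrA. Qed.
Fact free_addC : commutative free_add.
Proof. by move=> x y; apply: freeP => L phi; rewrite !free_valS addrC. Qed.
Fact free_add0 : left_id (\pi_free [::]) free_add.
Proof. by move=> x; apply: freeP => L phi; rewrite !free_valS add0r. Qed.
Fact free_addN : left_inverse (\pi_free [::]) (free_scale (-1)) free_add.
Proof.
by move=> x; apply: freeP => L phi; rewrite !free_valS scaleN1r addNr.
Qed.
HB.instance Definition _ :=
  GRing.isZmodule.Build free free_addA free_addC free_add0 free_addN.

Fact free_scaleA a b x : free_scale a (free_scale b x) = free_scale (a * b) x.
Proof. by apply: freeP => L phi; rewrite !free_valS scalerA. Qed.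
Fact free_scale1 : left_id 1 free_scale.
Proof. by move=> x; apply: freeP => L phi; rewrite !free_valS scale1r. Qed.
Fact free_scaleDr : right_distributive free_scale +%R.
Proof. by move=> a x y; apply: freeP => L phi; rewrite !free_valS scalerDr. Qed.
Fact free_scaleDl x : {morph free_scale^~ x : a b / a + b}.
Proof. by move=> a b; apply: freeP => L phi; rewrite !free_valS scalerDl. Qed.
HB.instance Definition _ := GRing.Zmodule_isLmodule.Build R free
  free_scaleA free_scale1 free_scaleDr free_scaleDl.

Definition gen (x : X) : free := \pi_free [:: (1, x)].

Fact free_val_linear (L : lmodType R) (phi : X -> L) : linear (free_val phi).
Proof. by move=> a x y; rewrite free_val_add free_val_scale. Qed.
Definition free_lift (L : lmodType R) (phi : X -> L) : {linear free -> L} :=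
  mk_linear (free_val_linear phi).

Lemma free_lift_gen (L : lmodType R) (phi : X -> L) x :
  free_lift phi (gen x) = phi x.
Proof. by rewrite /= free_valE /wsum big_seq1 scale1r. Qed.

Lemma free_ext (L : lmodType R) (f g : {linear free -> L}) :
  (forall x, f (gen x) = g (gen x)) -> f =1 g.
Proof.
have gE s : \pi_free s = \sum_(p <- s) p.1 *: gen p.2.
  elim: s => [|p s IHs]; first by rewrite big_nil.
  rewrite big_cons -IHs; apply: freeP => L' phi.
  rewrite [RHS]free_val_add [free_val _ (_ *: _)]free_val_scale !free_valE.
  by rewrite /wsum big_cons big_seq1 scale1r.
move=> fg x; rewrite -[x]reprK gE !linear_sum.
by apply: eq_bigr => p _; rewrite !linearZ fg.
Qed.
End FreeModule.

(** * Baer's criterion *)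

Section Baer.
Variable R : comPzRingType.
Implicit Types B M : lmodType R.

(** By linearity [G] is then single-valued: the graph of a linear map from a submodule of [B] to
    [M]. *)
Definition functional B M (G : submodule (B * M)%type) : Prop :=
  forall x, G (0, x) -> x = 0.

(* Partial linear maps on an ideal are encoded by their graphs. *)
Definition baer M : Prop :=
  forall G : submodule (R^o * M)%type, functional G ->
  exists m, forall a x, G (a, x) -> x = a *: m.

Lemma functional_eq B M (G : submodule (B * M)%type) : functional G ->
  forall b x y, G (b, x) -> G (b, y) -> x = y.
Proof.
move=> Gf b x y Gx Gy; apply/subr0_eq/Gf.
by have := in_subB Gx Gy; rewrite -[(b, x) - _]/(b - b, x - y) subrr.
Qed.

(** Zorn's lemma yields a maximal graph of a partial linear map containing [G]; Baer's condition
    shows that it is defined everywhere. *)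
Lemma baer_extend M : baer M -> forall B (G : submodule (B * M)%type),
  functional G -> exists f : {linear B -> M}, forall b x, G (b, x) -> f b = x.
Proof.
move=> Mb B G Gf.
(* [Zorn_bigcup] also asks for the union of the empty chain, so the family must contain the empty
   set: inclusion of [G] is required of nonempty [X] only. *)
pose P (X : set (B * M)) := [/\ forall p, X p -> forall q, G q -> X q,
  forall a p q, X p -> X q -> X (a *: p + q) & forall x, X (0, x) -> x = 0].
have PG : P G by split=> //; apply: in_subP.
have [F FP Ftot|A [[GA Alin Af] Amax]] := @Zorn_bigcup _ P.
  split=> [p [X FX Xp] q Gq|a p q [X FX Xp] [Y FY Yq]|x [X FX X0]].
  - by exists X => //; have [XG _ _] := FP _ FX; apply: (XG p).
  - have [XY|YX] := Ftot _ _ FX FY.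
      by exists Y => //; have [_ Yl _] := FP _ FY; apply: Yl => //; apply: XY.
    by exists X => //; have [_ Xl _] := FP _ FX; apply: Xl => //; apply: YX.
  - by have [_ _] := FP _ FX; apply.
(* Were [A] empty, the nonempty set [G] would be larger. *)
have A0 : A (0 : B * M)%type.
  apply: contrapT => nA0; apply: (Amax G) => //; split=> [p Ap|GsubA].
    by case: nA0; apply: (GA p) => //; apply: in_sub0.
  exact/nA0/GsubA/in_sub0.
have {}GA : forall q, G q -> A q by apply: (GA 0).
pose AS := Submodule A0 Alin.
(* The scalars [a] with [a *: b] in the domain of [A] form an ideal, on which [A] induces a partial
   map. Baer's condition gives the candidate value [m], and maximality of [A] against [A'], the span
   of [A] and [(b, m)], forces [A (b, m)]. *)
have tot b : exists m, A (b, m).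
  pose Db (p : R^o * M) := A (p.1 *: b, p.2).
  have Db0 : Db 0 by rewrite /Db scale0r.
  have DbP a p q : Db p -> Db q -> Db (a *: p + q).
    rewrite /Db /= => Dp Dq; rewrite scalerDl -[a *: p.1]/(a * p.1) -scalerA.
    exact: (Alin a _ _ Dp Dq).
  have [|m mP] := Mb (Submodule Db0 DbP).
    by move=> x; rewrite /= /Db /= scale0r; apply: Af.
  pose A' : set (B * M) :=
    fun p => exists q a, A q /\ p = (q.1 + a *: b, q.2 + a *: m).
  have AA' : subset A A'.
    by move=> [x y] Axy; exists (x, y), 0; rewrite !scale0r !addr0.
  have PA' : P A'.
    split.
    - by move=> _ _ q /GA /AA'.
    - move=> c _ _ [q [a [Aq ->]]] [q' [a' [Aq' ->]]].
      exists (c *: q + q'), (c * a + a'); split.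
        exact: (in_subP (s := AS) c Aq Aq').
      by congr pair; rewrite /= scalerDr addrACA scalerDl !scalerA.
    - move=> x [[y z] [a [Ayz /= [/esym y0 ->]]]].
      have Da : Db (- a, z) by rewrite /Db /= scaleNr -(addr0_eq y0) opprK.
      by rewrite (mP _ _ Da) scaleNr addNr.
  exists m; apply: contrapT => nAm; apply: (Amax A') => //; split=> // A'A.
  by apply/nAm/A'A; exists 0, 1; rewrite !add0r !scale1r.
have [f fP] := choice tot.
have fl : linear f.
  move=> a x y; apply: (@functional_eq _ _ AS Af (a *: x + y)) => //.
  exact: (in_subP (s := AS) a (fP x) (fP y)).
exists (mk_linear fl) => b x /GA Gbx.
exact: (@functional_eq _ _ AS Af b).
Qed.

Lemma baer_injective M : baer M -> injective_module M.
Proof.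
move=> Mb A B f fi h.
(* [G] is the graph of [h] after the inverse of [f] on the image of [f]. *)
pose G (p : B * M) := exists a, p = (f a, h a).
have G0 : G 0 by exists 0; rewrite !linear0.
have GP c p q : G p -> G q -> G (c *: p + q).
  by move=> [x ->] [y ->]; exists (c *: x + y); rewrite !linearP.
have [x|k kP] := baer_extend Mb (G := Submodule G0 GP).
  move=> [a [a0 ->]]; suff -> : a = 0 by rewrite linear0.
  by apply: fi; rewrite -a0 linear0.
by exists k; apply/homP => a /=; apply: kP; exists a.
Qed.
End Baer.

(** * Q/Z as an injective cogenerator over Z *)

Section RatModInt.

Fact int_num_subP :
  forall (a : int) (x y : zmodule rat), x \is a Num.int -> y \is a Num.int ->
  a *: x + y \is a Num.int.
Proof.
move=> a x y xi yi; rewrite scalezrE; apply: rpredD yi.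
exact: rpredMz.
Qed.

Definition int_sub : submodule (zmodule rat) :=
  @Submodule _ (zmodule rat) (fun x => x \is a Num.int) (rpred0 _) int_num_subP.

Definition rat_mod_int : lmodType int := quot int_sub.

Lemma rat_mod_int_divisible (n : int) (x : rat_mod_int) : n != 0 ->
  exists y, n *: y = x.
Proof.
move=> n0; have [q <-] := quot_proj_surj x.
exists (quot_proj int_sub (q / n%:~R)); rewrite -linearZ scalezrE.
congr (quot_proj int_sub _).
by rewrite -[_ *~ _]mulrzr divfK ?intr_eq0.
Qed.

(** The generator is the least positive element, or 0 if there is none; a nonzero remainder modulo
    it would be a smaller positive element. *)
Lemma int_ideal_principal (S : submodule int^o) :
  exists n : int, S n /\ forall a : int, S a -> exists q : int, a = q * n.
Proof.
have Sabs (a : int) : S a -> S `|a|%N%:Z.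
  by rewrite abszE; case: (ger0P a) => // _; apply: in_subN.
have [ex|nex] := pselect (exists n, (0 < n)%N && `[< S n%:Z >]); last first.
  exists 0; split=> [|a Sa]; first exact: in_sub0.
  exists 0; rewrite mulr0; apply: contrapT => /eqP a0; apply: nex.
  by exists `|a|%N; rewrite absz_gt0 a0; apply/asboolP/Sabs.
case: (ex_minnP ex) => n /andP[n0 /asboolP Sn] nmin.
exists n%:Z; split=> // a Sa; exists (a %/ n)%Z.
have Sr : S `|(a %% n)%Z|%N%:Z.
  by apply: Sabs; apply: (in_subB Sa); apply: (in_subZ (a %/ n)%Z Sn).
rewrite {1}[a](divz_eq a n); suff -> : (a %% n)%Z = 0 by rewrite addr0.
apply/eqP; rewrite -absz_eq0 -leqn0 leqNgt; apply/negP => r0.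
have : (n <= `|(a %% n)%Z|)%N by apply: nmin; rewrite r0; apply/asboolP.
rewrite leqNgt -ltz_nat gez0_abs ?modz_ge0 -?lt0n //.
by rewrite ltz_pmod // ltz_nat.
Qed.

(** Ideals of Z being principal, a partial map is determined by its value [x] at a generator [n],
    and divisibility supplies [y] with [n *: y = x]. *)
Lemma rat_mod_int_baer : baer rat_mod_int.
Proof.
move=> G Gf.
have D0 : exists x, G (0, x) by exists 0; apply: in_sub0.
have DP (a b c : int^o) : (exists x, G (b, x)) -> (exists x, G (c, x)) ->
    exists x, G (a *: b + c, x).
  move=> [x Gx] [y Gy]; exists (a *: x + y).
  exact: in_subP a _ _ Gx Gy.
have [n [[x Gx] nP]] := int_ideal_principal (Submodule D0 DP).
have [y yx] : exists y, n *: y = x.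
  (* For [n = 0] divisibility says nothing, but then [x] is the value at 0 and vanishes. *)
  have [n0|] := eqVneq n 0; last exact: rat_mod_int_divisible.
  by exists 0; rewrite scaler0; apply/esym/Gf; rewrite -n0.
exists y => a z Gz; have [q aE] := nP _ (ex_intro _ z Gz).
rewrite aE -scalerA yx; apply: (functional_eq Gf Gz).
by rewrite aE; exact: (in_subZ q Gx).
Qed.

Lemma rat_mod_int_cogen (V : lmodType int) (x : V) : x != 0 ->
  exists f : {linear V -> rat_mod_int}, f x != 0.
Proof.
move=> x0.
(* It suffices that [q] be killed by every integer that kills [x]: then sending [n *: x] to [n *: q]
   is well defined on the cyclic group of [x] and extends to [V]. *)
suff [q qx q0] : exists2 q : rat_mod_int,
    (forall n : int, n *: x = 0 -> n *: q = 0) & q != 0.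
  pose G (p : V * rat_mod_int) := exists n : int, p = (n *: x, n *: q).
  have G0 : G 0 by exists 0; rewrite !scale0r.
  have GP c p p' : G p -> G p' -> G (c *: p + p').
    move=> [n ->] [m ->]; exists (c * n + m).
    by rewrite !scalerDl -!scalerA.
  have [y|f fP] := baer_extend rat_mod_int_baer (G := Submodule G0 GP).
    by move=> [n [/esym /qx nq ->]].
  exists f; suff -> : f x = q by [].
  by apply: fP; exists 1; rewrite !scale1r.
have inv_neq0 (n : int) : n != 0 -> n \isn't a GRing.unit ->
    quot_proj int_sub (n%:~R^-1 : rat) != 0.
  move=> n0 nU; apply/eqP => /quot_proj0 /= /intrP[m mE].
  move/negP: nU; apply; apply/unitrP; exists m.
  suff mn : m * n = 1 by split; rewrite // mulrC.
  by apply: (@intr_inj rat); rewrite intrM -mE mulVf ?intr_eq0.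
have A0 : 0 *: x = 0 by rewrite scale0r.
have AP (a b c : int^o) : b *: x = 0 -> c *: x = 0 -> (a *: b + c) *: x = 0.
  by move=> bx cx; rewrite scalerDl -[a *: b]/(a * b) -scalerA bx cx scaler0 addr0.
have [n [nx nP]] := int_ideal_principal (Submodule A0 AP).
(* [d] is the generator of the annihilator of [x], not a unit since [x] is nonzero, or 2 when the
   annihilator is zero. The class of 1/d then has the two properties wanted of [q]. *)
have [d [d0 dU dP]] : exists d : int, [/\ d != 0, d \isn't a GRing.unit &
    forall a : int, a *: x = 0 -> exists q, a = q * d].
  have [n0|n0] := eqVneq n 0.
    exists 2; split=> // a /nP[q ->]; exists 0.
    by rewrite n0 mulr0 mul0r.
  exists n; split=> //; apply: contra x0 => nU.
  by rewrite -[x]scale1r -(mulVr nU) -scalerA [_ *: x]nx scaler0.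
exists (quot_proj int_sub (d%:~R^-1 : rat)) => [a /dP[q ->]|]; last exact: inv_neq0.
rewrite -linearZ; apply/quot_proj0 => /=.
rewrite scalezrE -mulrzr intrM mulrC mulfK ?intr_eq0 //.
Qed.
End RatModInt.

(** * The module structure on Hom *)

Section HomModule.
Variables (R : comPzRingType) (U V : lmodType R).
Implicit Types f g : hom U V.

Fact hom_scale_linear (a : R) f : linear (fun x => a *: f x).
Proof. by move=> b x y; rewrite linearP scalerDr !scalerA mulrC. Qed.
Definition hom_scale (a : R) f : hom U V := mk_linear (hom_scale_linear a f).

Fact hom_scaleA a b f : hom_scale a (hom_scale b f) = hom_scale (a * b) f.
Proof. by apply/homP => x; apply: scalerA. Qed.
Fact hom_scale1 : left_id 1 hom_scale.
Proof. by move=> f; apply/homP => x; apply: scale1r. Qed.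
Fact hom_scaleDr : right_distributive hom_scale +%R.
Proof. by move=> a f g; apply/homP => x; apply: scalerDr. Qed.
Fact hom_scaleDl f : {morph hom_scale^~ f : a b / a + b}.
Proof. by move=> a b; apply/homP => x; apply: scalerDl. Qed.
HB.instance Definition _ := GRing.Zmodule_isLmodule.Build R (hom U V)
  hom_scaleA hom_scale1 hom_scaleDr hom_scaleDl.

Lemma homZE a f x : (a *: f) x = a *: f x. Proof. by []. Qed.
End HomModule.

Fact hom_pre_linear (R : comPzRingType) (A B V : lmodType R)
  (f : {linear A -> B}) : linear (hom_pre f V).
Proof. by move=> a h k; apply/homP. Qed.
HB.instance Definition _ (R : comPzRingType) (A B V : lmodType R)
  (f : {linear A -> B}) :=
  GRing.isLinear.Build R (hom B V) (hom A V) *:%R (hom_pre f V)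
    (hom_pre_linear f).

Fact hom_post_linear (R : comPzRingType) (U A B : lmodType R)
  (g : {linear A -> B}) : linear (hom_post U g).
Proof. by move=> a h k; apply/homP => x; apply: linearP. Qed.
HB.instance Definition _ (R : comPzRingType) (U A B : lmodType R)
  (g : {linear A -> B}) :=
  GRing.isLinear.Build R (hom U A) (hom U B) *:%R (hom_post U g)
    (@hom_post_linear _ U _ _ g).

(** * The character module Hom_Z(R, Q/Z) *)

Section CharacterModule.
Variable R : comPzRingType.

Lemma zmodule_linear (U V : lmodType int) (f : U -> V) :
  {morph f : x y / x + y} -> linear f.
Proof.
move=> fD a x y; rewrite fD.
have f0 : f 0 = 0 by apply: (addrI (f 0)); rewrite -fD !addr0.
have fN z : f (- z) = - f z by apply: (addrI (f z)); rewrite -fD !subrr.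
have fn (n : nat) z : f (n%:Z *: z) = n%:Z *: f z.
  elim: n => [|n IHn]; first by rewrite !scale0r.
  by rewrite intS !scalerDl fD IHn !scale1r.
congr (_ + _); case: a => n; first exact: fn.
by rewrite NegzE !scaleNr fN fn.
Qed.

(** The alias keeps the R-action [char_scale] apart from the Z-module structure that the hom type
    already carries. *)
Definition charmod : Type := hom (zmodule R) rat_mod_int.
HB.instance Definition _ := GRing.Zmodule.on charmod.

Fact char_scale_linear (a : R) (chi : charmod) :
  linear ((fun r => chi (r * a)) : zmodule R -> rat_mod_int).
Proof.
apply: zmodule_linear => r s.
by rewrite mulrDl -[_ + _ :> R]/(_ + _ :> zmodule R) linearD.
Qed.
Definition char_scale a (chi : charmod) : charmod :=
  mk_linear (char_scale_linear a chi).

Fact char_scaleA a b chi : char_scale a (char_scale b chi) = char_scale (a * b) chi.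
Proof. by apply/homP => r /=; rewrite mulrA. Qed.
Fact char_scale1 : left_id 1 char_scale.
Proof. by move=> chi; apply/homP => r /=; rewrite mulr1. Qed.
Fact char_scaleDr : right_distributive char_scale +%R.
Proof. by move=> a f g; apply/homP. Qed.
Fact char_scaleDl chi : {morph char_scale^~ chi : a b / a + b}.
Proof.
move=> a b; apply/homP => r /=.
by rewrite mulrDr -[_ + _ :> R]/(_ + _ :> zmodule R) linearD.
Qed.
HB.instance Definition _ := GRing.Zmodule_isLmodule.Build R charmod
  char_scaleA char_scale1 char_scaleDr char_scaleDl.

(* The adjunction between restriction of scalars and coinduction from the
   integers. *)
Lemma charmod_coinduced (B : lmodType R)
    (k : {linear (zmodule B : lmodType int) -> rat_mod_int}) :
  exists K : {linear B -> charmod}, forall b r, K b r = k (r *: b).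
Proof.
have kD (x y : B) : k (x + y) = k x + k y.
  by rewrite -[x + y]/(_ + _ :> zmodule B) linearD.
have kl b : linear ((fun r => k (r *: b)) : zmodule R -> rat_mod_int).
  by apply: zmodule_linear => r s; rewrite scalerDl kD.
have Kl : linear (fun b => mk_linear (kl b) : charmod).
  by move=> a x y; apply/homP => r /=; rewrite scalerDr scalerA kD.
by exists (mk_linear Kl).
Qed.

(** A map into [charmod] amounts to the additive map given by evaluation at 1. The latter extends
    along [f] because Q/Z is injective over Z, and coinduction turns the extension back into an
    R-linear map. *)
Lemma charmod_injective : injective_module charmod.
Proof.
move=> A B f fi h.
have hDE (x y : A) : h (x + y) 1 = h x 1 + h y 1 by rewrite linearD.
have hZ (r : R) x : h (r *: x) 1 = h x r by rewrite linearZ /= mul1r.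
have evl : linear ((fun x => h x 1) : zmodule A -> rat_mod_int).
  exact: zmodule_linear.
have fl : linear (f : zmodule A -> zmodule B).
  by apply: zmodule_linear => x y; rewrite -[f _]/(f ((x : A) + y)) linearD.
have [k /homP kE] := baer_injective rat_mod_int_baer (f := mk_linear fl) fi
  (mk_linear evl).
have [K KE] := charmod_coinduced k.
exists K; apply/homP => a; apply/homP => r /=.
by rewrite KE -linearZ -hZ; apply: kE.
Qed.

Lemma charmod_cogen (M : lmodType R) (x : M) : x != 0 ->
  exists f : {linear M -> charmod}, f x != 0.
Proof.
move=> /(@rat_mod_int_cogen (zmodule M))[k kx].
have [K KE] := charmod_coinduced k.
exists K; apply: contra kx => /eqP Kx.
by rewrite -[x]scale1r -KE Kx.
Qed.
End CharacterModule.

(** * Left exactness of Hom *)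

Section ExactSequences.
Variable R : comPzRingType.
Implicit Types A B C D J M U V : lmodType R.

Lemma exact_comp0 A B C (f : {linear A -> B}) (g : {linear B -> C}) :
  exact f g -> forall x, g (f x) = 0.
Proof. by move=> fg x; apply/fg; exists x. Qed.

Lemma hom_pre_inj B C (g : {linear B -> C}) V :
  surjective g -> injective (hom_pre g V).
Proof. by move=> gs h k /homP hk; apply/homP => z; have [y <-] := gs z; apply: hk. Qed.

Lemma hom_pre_exact A B C (f : {linear A -> B}) (g : {linear B -> C}) V :
  exact f g -> surjective g -> exact (hom_pre g V) (hom_pre f V).
Proof.
move=> fg gs h; split=> [/homP hf|[k <-]]; last first.
  by apply/homP => x /=; rewrite (exact_comp0 fg) linear0.
have [|k kE] := @factor_surj _ _ _ _ g h gs.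
  by move=> y /fg[x <-]; apply: hf.
by exists k; apply/homP.
Qed.

Lemma hom_post_inj A B (f : {linear A -> B}) U :
  injective f -> injective (hom_post U f).
Proof. by move=> fi h k /homP hk; apply/homP => x; apply/fi/hk. Qed.

Lemma hom_post_exact A B C (f : {linear A -> B}) (g : {linear B -> C}) U :
  injective f -> exact f g -> exact (hom_post U f) (hom_post U g).
Proof.
move=> fi fg h; split=> [/homP gh|[k <-]]; last first.
  by apply/homP => x /=; rewrite (exact_comp0 fg).
have [|k kE] := @factor_inj _ _ _ _ f h fi; first by move=> x; apply/fg/gh.
by exists k; apply/homP.
Qed.

Lemma short_exact_hom_post A B C (f : {linear A -> B}) (g : {linear B -> C}) U :
  short_exact f g -> surjective (hom_post U g) ->
  short_exact (hom_post U f) (hom_post U g).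
Proof.
by move=> [fi fg _] gs; split; [apply: hom_post_inj|apply: hom_post_exact|].
Qed.

Lemma short_exact_hom_pre A B C (f : {linear A -> B}) (g : {linear B -> C}) V :
  short_exact f g -> surjective (hom_pre f V) ->
  short_exact (hom_pre g V) (hom_pre f V).
Proof.
by move=> [_ fg gs] fs; split; [apply: hom_pre_inj|apply: hom_pre_exact|].
Qed.

(** For the empty class every short exact sequence is pure, so results on [pure_injective] and
    [pure_flat] specialize to ordinary injectivity and flatness. *)
Lemma injective_moduleP V :
  injective_module V <-> pure_injective (fun _ => False) V.
Proof.
split=> [Vi A B C f g [fg _]|Vi A B f fi].
  by apply: short_exact_hom_pre => //; apply: Vi; case: fg.
have [] // := Vi _ _ _ f (quot_proj (im_sub f)).
by split=> //; apply: short_exact_coker.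
Qed.

Lemma flatP M : flat M <-> pure_flat (fun _ => False) M.
Proof.
by split=> Mf A B C f g => [[fg _]|fg]; apply: Mf.
Qed.
End ExactSequences.

(** * Exactness transported along bijections *)

Section Transport.
Variables (A B C A' B' C' : zmodType).
Variables (f : A -> B) (g : B -> C) (f' : A' -> B') (g' : B' -> C').
Variables (a : A -> A') (b : B -> B') (c : C -> C').
Hypotheses (ai : injective a) (asurj : surjective a).
Hypotheses (bi : injective b) (bs : surjective b).
Hypotheses (ci : injective c) (cs : surjective c) (c0 : c 0 = 0).
Hypotheses (fE : forall x, f' (a x) = b (f x)).
Hypotheses (gE : forall y, g' (b y) = c (g y)).

Lemma exact_transport : exact f g <-> exact f' g'.
Proof.
have gP y : g' (b y) = 0 <-> g y = 0.
  by rewrite gE -c0; split=> [/ci|->].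
have fP y : (exists x, f' x = b y) <-> (exists x, f x = y).
  split=> [[x']|[x <-]]; last by exists (a x).
  by have [x <-] := asurj x'; rewrite fE => /bi; exists x.
split=> fg y; last by apply: iff_trans (fP y); apply: iff_trans (fg _); apply: iff_sym.
have [z <-] := bs y.
by apply: iff_trans (iff_sym (fP z)); apply: iff_trans (fg z).
Qed.

Lemma short_exact_transport : short_exact f g <-> short_exact f' g'.
Proof.
split=> -[fi fg gs]; split; first 2 last.
- by move=> z'; have [z <-] := cs z'; have [y <-] := gs z; exists (b y).
- move=> x y fxy; apply/ai/fi.
  by rewrite !fE fxy.
- exact/exact_transport.
- move=> z; have [y' y'E] := gs (c z); have [y yE] := bs y'.
  by exists y; apply: ci; rewrite -gE yE.
- move=> x' y'; have [x <-] := asurj x'; have [y <-] := asurj y'.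
  by rewrite !fE => /bi/fi ->.
- exact/exact_transport.
Qed.
End Transport.

(** * Duality into the character module preserves and reflects exactness *)

Section Duality.
Variable R : comPzRingType.
Implicit Types A B C D J M N U V : lmodType R.

Local Notation E := (charmod R).

Lemma dual_separates M (x : M) : (forall f : hom M E, f x = 0) -> x = 0.
Proof.
move=> fx; apply/eqP/negP => /negP/charmod_cogen[f /eqP]; apply.
exact: fx.
Qed.

(** One direction is injectivity of [E]. For the other, functionals on [A] extend along [f], so all
    of them vanish on its kernel, and [E] separates points. *)
Lemma dual_injP A B (f : {linear A -> B}) :
  injective f <-> surjective (hom_pre f E).
Proof.
split=> [|fs]; first exact: charmod_injective.
apply: inj_linear => x fx; apply: dual_separates => h.
by have [k <-] := fs h; rewrite /= fx linear0.
Qed.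

Lemma quot_im_eq0 A B V (f : {linear A -> B}) (h : hom (quot (im_sub f)) V) x :
  hom_pre (quot_proj (im_sub f)) V h (f x) = 0.
Proof.
have fx0 : quot_proj (im_sub f) (f x) = 0 by apply/quot_proj0; exists x.
exact: etrans (congr1 h fx0) (linear0 h).
Qed.

(** A functional on the cokernel of [g], pulled back to [C], dies after [g]. If precomposition with
    [g] is injective, all such functionals are zero, and so is the cokernel. *)
Lemma dual_surjP B C (g : {linear B -> C}) :
  surjective g <-> injective (hom_pre g E).
Proof.
split=> [|gi z]; first exact: hom_pre_inj.
apply/(quot_proj0 (im_sub g)); apply: dual_separates => h.
have /gi/homP/(_ z) : hom_pre g E (hom_pre (quot_proj (im_sub g)) E h) =
    hom_pre g E 0 by apply/homP => y; apply: quot_im_eq0.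
exact.
Qed.

Lemma dual_exactP A B C (f : {linear A -> B}) (g : {linear B -> C}) :
  exact f g <-> exact (hom_pre g E) (hom_pre f E).
Proof.
split=> [fg h|fg y].
  split=> [/homP hf|[k <-]]; last first.
    by apply/homP => x /=; rewrite (exact_comp0 fg) linear0.
  (* [h] kills the kernel of [g], hence descends to the image of [g], from where injectivity of [E]
     extends it to [C]. *)
  have [|p pE] := @factor_inj _ _ _ _ (sub_incl (im_sub g)) g (@sub_incl_inj _ _ _).
    by move=> y; apply/sub_inclP; exists y.
  have [z||k kE] := @factor_surj _ _ _ _ p h.
  - have /sub_inclP[y yE] : exists z', sub_incl (im_sub g) z' = sub_incl (im_sub g) z.
      by exists z.
    by exists y; apply: (@sub_incl_inj _ _ (im_sub g)); rewrite pE.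
  - move=> y py; have /fg[x <-] : g y = 0 by rewrite -pE py linear0.
    exact: hf.
  have [K /homP KE] := charmod_injective (@sub_incl_inj _ _ (im_sub g)) k.
  by exists K; apply/homP => y /=; rewrite -pE -kE; apply: KE.
split=> [gy|[x <-]]; last first.
  apply: dual_separates => h.
  have : hom_pre f E (hom_pre g E h) = 0 by apply/fg; exists h.
  by move=> /homP/(_ x).
(* Functionals on the cokernel of [f], pulled back to [B], factor through [g] and so vanish at [y];
   hence [y] lies in the image of [f]. *)
apply/(quot_proj0 (im_sub f)); apply: dual_separates => h.
have /fg[l /homP lE] : hom_pre f E (hom_pre (quot_proj (im_sub f)) E h) = 0.
  by apply/homP => x; apply: quot_im_eq0.
by rewrite -[LHS](lE y) /= gy linear0.
Qed.

Lemma dual_short_exactP A B C (f : {linear A -> B}) (g : {linear B -> C}) :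
  short_exact f g <-> short_exact (hom_pre g E) (hom_pre f E).
Proof.
split=> -[fi fg gs]; split.
- exact/dual_surjP.
- exact: (dual_exactP f g).1 fg.
- exact/dual_injP.
- exact/dual_injP.
- exact: (dual_exactP f g).2 fg.
- exact/dual_surjP.
Qed.
End Duality.

(** * The tensor-hom adjunction *)

Section TensorHom.
Variable R : comPzRingType.
Implicit Types A B C J M N U V : lmodType R.

Lemma tensor_ext M A V (f g : {linear tensor M A -> V}) :
  (forall m a, f (tpure m a) = g (tpure m a)) -> f =1 g.
Proof.
move=> fg; elim/tensorW=> s; rewrite tensor_sum !linear_sum.
by apply: eq_bigr => p _; apply: fg.
Qed.

Section Curry.
Variables (M A V : lmodType R).

Fact curryr_subproof1 (k : hom (tensor M A) V) a :
  linear (fun m => k (tpure m a)).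
Proof. by move=> c m m'; rewrite tpure_linearl linearP. Qed.
Fact curryr_subproof2 (k : hom (tensor M A) V) :
  linear (fun a => mk_linear (curryr_subproof1 k a) : hom M V).
Proof.
by move=> c a a'; apply/homP => m /=; rewrite tpure_linearr linearP.
Qed.
Definition curryr (k : hom (tensor M A) V) : hom A (hom M V) :=
  mk_linear (curryr_subproof2 k).

Fact curryl_subproof1 (k : hom (tensor M A) V) m :
  linear (fun a => k (tpure m a)).
Proof. by move=> c a a'; rewrite tpure_linearr linearP. Qed.
Fact curryl_subproof2 (k : hom (tensor M A) V) :
  linear (fun m => mk_linear (curryl_subproof1 k m) : hom A V).
Proof.
by move=> c m m'; apply/homP => a /=; rewrite tpure_linearl linearP.
Qed.
Definition curryl (k : hom (tensor M A) V) : hom M (hom A V) :=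
  mk_linear (curryl_subproof2 k).

Lemma curryr_inj : injective curryr.
Proof.
move=> h k /homP hk; apply/homP; apply: tensor_ext => m a.
by have /homP/(_ m) := hk a.
Qed.
Lemma curryr_surj : surjective curryr.
Proof.
move=> h; have [||k [kE _]] := @tensor_universal _ M A V (fun m a => h a m).
- by move=> a c m m'; rewrite linearP.
- by move=> m c a a'; rewrite linearP.
- by exists k; apply/homP => a; apply/homP => m; apply: kE.
Qed.
Lemma curryl_inj : injective curryl.
Proof.
move=> h k /homP hk; apply/homP; apply: tensor_ext => m a.
by have /homP/(_ a) := hk m.
Qed.
Lemma curryl_surj : surjective curryl.
Proof.
move=> h; have [||k [kE _]] := @tensor_universal _ M A V (fun m a => h m a).
- by move=> a c m m'; rewrite linearP.
- by move=> m c a a'; rewrite linearP.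
- by exists k; apply/homP => m; apply/homP => a; apply: kE.
Qed.
Lemma curryr0 : curryr 0 = 0.
Proof. by apply/homP => a; apply/homP. Qed.
Lemma curryl0 : curryl 0 = 0.
Proof. by apply/homP => a; apply/homP. Qed.
End Curry.

Lemma curryr_natural M A B V (f : {linear A -> B}) (k : hom (tensor M B) V) :
  hom_pre f (hom M V) (curryr k) = curryr (hom_pre (tensor_map M f) V k).
Proof.
by apply/homP => a; apply/homP => m /=; rewrite tensor_map_tpure.
Qed.

Lemma curryl_natural M A B V (f : {linear A -> B}) (k : hom (tensor M B) V) :
  hom_post M (hom_pre f V) (curryl k) = curryl (hom_pre (tensor_map M f) V k).
Proof.
by apply/homP => a; apply/homP => m /=; rewrite tensor_map_tpure.
Qed.

Local Notation E := (charmod R).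

(** [curryr] identifies the dual of the tensor functor of [M] with Hom(-, M^+), and duality reflects
    exactness. *)
Lemma short_exact_tensor_pre M A B C (f : {linear A -> B}) (g : {linear B -> C}) :
  short_exact (tensor_map M f) (tensor_map M g) <->
  short_exact (hom_pre g (hom M E)) (hom_pre f (hom M E)).
Proof.
apply: iff_trans (dual_short_exactP _ _) _.
apply: short_exact_transport; try exact: curryr_natural;
  by [apply: curryr_inj | apply: curryr_surj | apply: curryr0].
Qed.

(** The same with [curryl], which places the dual on the sequence instead of on [M]; this form
    compares the tests of Gorenstein flatness and injectivity. *)
Lemma short_exact_tensor_post M A B C (f : {linear A -> B}) (g : {linear B -> C}) :
  short_exact (tensor_map M f) (tensor_map M g) <->
  short_exact (hom_post M (hom_pre g E)) (hom_post M (hom_pre f E)).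
Proof.
apply: iff_trans (dual_short_exactP _ _) _.
apply: short_exact_transport; try exact: curryl_natural;
  by [apply: curryl_inj | apply: curryl_surj | apply: curryl0].
Qed.

Lemma pure_flatP (X : lmodType R -> Prop) M :
  pure_flat X M <-> pure_injective X (hom M E).
Proof.
split=> MX A B C f g fg.
  by apply: (short_exact_tensor_pre M f g).1; apply: MX.
by apply: (short_exact_tensor_pre M f g).2; apply: MX.
Qed.

Lemma flat_dualP M : flat M <-> injective_module (hom M E).
Proof.
apply: iff_trans (flatP _) _; apply: iff_trans (pure_flatP _ _) _.
exact: iff_sym (injective_moduleP _).
Qed.

Lemma tensor_map_surj M B C (g : {linear B -> C}) :
  surjective g -> surjective (tensor_map M g).
Proof.
move=> gs; apply/dual_surjP => h k hk; apply: curryr_inj.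
by apply: (hom_pre_inj gs); rewrite !curryr_natural hk.
Qed.

(** Right exactness of the tensor product, read off by duality from left exactness of Hom(-,
    M^+). *)
Lemma tensor_map_exact M A B C (f : {linear A -> B}) (g : {linear B -> C}) :
  exact f g -> surjective g -> exact (tensor_map M f) (tensor_map M g).
Proof.
move=> fg gs; apply/dual_exactP.
have := hom_pre_exact (V := hom M E) fg gs.
apply: (exact_transport (a := @curryr M C E) (b := @curryr M B E)
  (c := @curryr M A E) _ _ _ _ _ _ _).2; try exact: curryr_natural;
  by [apply: curryr_inj | apply: curryr_surj | apply: curryr0].
Qed.
End TensorHom.

(** * Flat modules, and flatness of duals of injectives over a coherent ring *)

Section FlatModules.
Variable R : comPzRingType.
Implicit Types A B C I J M N U V : lmodType R.

Local Notation E := (charmod R).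

(** The dual of [free R X] is a product of copies of [E] indexed by [X], so maps into it extend
    coordinate by coordinate. *)
Lemma free_flat (X : choiceType) : flat (free R X).
Proof.
apply/flat_dualP => A B f fi h.
have hl x : linear (fun a => h a (gen R x) : E) by move=> c a b; rewrite linearP.
have kP x : exists k : hom B E, forall a, k (f a) = h a (gen R x).
  have [k /homP kE] := charmod_injective fi (mk_linear (hl x)).
  by exists k; apply: kE.
have [k kE] := choice kP.
have Kl : linear (fun b => free_lift (fun x => k x b) : hom (free R X) E).
  move=> c b b'; apply/homP; apply: free_ext => x.
  rewrite [RHS]homDE homZE !free_lift_gen.
  exact: linearP.
exists (mk_linear Kl); apply/homP => a; apply/homP; apply: free_ext => x.
by rewrite -kE; apply: free_lift_gen.
Qed.

Lemma free_lift_id_surj M : surjective (free_lift (id : M -> M)).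
Proof. by move=> x; exists (gen R x); apply: free_lift_gen. Qed.

Lemma tensor_map_comp M A B C (f : {linear A -> B}) (g : {linear B -> C})
    (h : {linear A -> C}) : (forall a, h a = g (f a)) ->
  forall x : tensor M A, tensor_map M h x = tensor_map M g (tensor_map M f x).
Proof.
move=> hE; elim/tensorW=> s; rewrite !tensor_mapE /tens_map -map_comp.
by congr (\pi_(tensor M C) _); apply: eq_map => p /=; rewrite hE.
Qed.

Lemma tpure0l M A (a : A) : tpure (0 : M) a = 0.
Proof. exact: linear0 (mk_linear (tpure_linearl a)). Qed.
Lemma tpure0r M A (m : M) : tpure m (0 : A) = 0.
Proof. exact: linear0 (mk_linear (tpure_linearr m)). Qed.

Lemma tensor_map0 M A B (f : {linear A -> B}) :
  (forall a, f a = 0) -> forall x : tensor M A, tensor_map M f x = 0.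
Proof.
move=> f0 x; rewrite (tensor_map_comp (f := f) (g := \0 : {linear B -> B})) //.
elim/tensorW: (tensor_map M f x) => s; rewrite tensor_mapE tensor_sum.
rewrite /tens_map big_map big1 // => p _ /=.
exact: tpure0r.
Qed.

Lemma row_linear n A (g : 'I_n -> A) :
  linear (fun v : 'rV[R]_n => \sum_i v 0 i *: g i).
Proof.
move=> a u v; rewrite scaler_sumr -big_split /=; apply: eq_bigr => i _.
by rewrite !mxE scalerDl scalerA.
Qed.

Lemma row_linear_delta n A (g : 'I_n -> A) i :
  mk_linear (row_linear g) (delta_mx 0 i) = g i.
Proof.
rewrite /= (bigD1 i) //= big1 ?addr0 => [|k ki]; rewrite mxE ?eqxx ?scale1r //.
by rewrite (negPf ki) andbF scale0r.
Qed.

Lemma tensor_row_sum M n (u : tensor M 'rV[R]_n) :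
  exists m : 'I_n -> M, u = \sum_i tpure (m i) (delta_mx 0 i).
Proof.
elim/tensorW: u => s; exists (fun i => \sum_(p <- s) p.2 0 i *: p.1).
rewrite tensor_sum.
have pE (m : M) (v : 'rV[R]_n) : tpure m v = \sum_i tpure (v 0 i *: m) (delta_mx 0 i).
  pose tm : {linear _ -> _} := mk_linear (tpure_linearr (N := 'rV[R]_n) m).
  rewrite -[LHS]/(tm v) {1}[v]row_sum_delta linear_sum.
  by apply: eq_bigr => i _; rewrite tpure_scale.
rewrite (eq_bigr _ (fun p _ => pE p.1 p.2)) exchange_big /=.
apply: eq_bigr => i _.
pose td : {linear M -> _} := mk_linear (tpure_linearl (delta_mx 0 i : 'rV[R]_n)).
by rewrite -[RHS]/(td _) linear_sum.
Qed.

Lemma tensor_fg M A (t : tensor M A) :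
  exists n (g : {linear 'rV[R]_n -> A}) u, t = tensor_map M g u.
Proof.
elim/tensorW: t => s.
pose g (i : 'I_(size s)) : A := (tnth (in_tuple s) i).2.
exists (size s), (mk_linear (row_linear g)).
exists (\sum_i tpure (tnth (in_tuple s) i).1 (delta_mx 0 i)).
rewrite linear_sum tensor_sum big_tnth; apply: eq_bigr => i _.
by rewrite /= tensor_map_tpure row_linear_delta.
Qed.

Section DualOfInjective.
Variable I : lmodType R.
Hypothesis Ii : injective_module I.

Local Notation F := (hom I E).

Lemma evaluation : exists ev : hom (tensor F I) E,
  forall (phi : F) x, ev (tpure phi x) = phi x.
Proof.
have idl : linear (id : F -> F) by [].
have [ev /homP evE] := curryl_surj (mk_linear idl : hom F F).
by exists ev => phi x; have /homP/(_ x) := evE phi.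
Qed.

(* For finitely presented [N], the map [F (x) N -> Hom(Hom(N, I), E)] sending
   [t] to [h |-> ev ((F (x) h) t)] is injective; injectivity of [I] turns the
   embedding [j] into a surjection [Hom(N', I) -> Hom(N, I)]. *)
Lemma fp_tensor_inj N N' (j : {linear N -> N'}) : finitely_presented N ->
  injective j -> injective (tensor_map F j).
Proof.
move=> [m [n [al [be [ab bs]]]]] ji; have [ev evE] := evaluation.
have evsum k A (h : {linear A -> I}) (phi : 'I_k -> F) (x : 'I_k -> A) :
    ev (tensor_map F h (\sum_i tpure (phi i) (x i))) = \sum_i phi i (h (x i)).
  by rewrite !linear_sum; apply: eq_bigr => i _ /=; rewrite tensor_map_tpure evE.
apply: inj_linear => t jt.
(* Extending [h] to [h'] along [j] shows that the value at [h] depends only on the image of [t]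
   under [j], which is zero. *)
have t0 (h : {linear N -> I}) : ev (tensor_map F h t) = 0.
  have [h' /homP h'E] := Ii ji h.
  rewrite (tensor_map_comp (f := j) (g := h')) ?jt ?linear0 // => a.
  exact/esym/h'E.
have [u tE] := tensor_map_surj (M := F) bs t.
have [phi uE] := tensor_row_sum u.
have w0l : linear (fun h : hom 'rV[R]_n I => \sum_i phi i (h (delta_mx 0 i))).
  move=> a h k; rewrite scaler_sumr -big_split /=; apply: eq_bigr => i _.
  exact: linearP.
pose w0 : hom (hom 'rV[R]_n I) E := mk_linear w0l.
have w0E h : w0 h = ev (tensor_map F h u) by rewrite uE evsum.
(* [w0], the functional induced by the lift [u] of [t], vanishes on maps factoring through [be]. The
   dual of the exact sequence Hom(N, I) -> Hom(R^n, I) -> Hom(R^m, I) then makes it factor through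
   restriction along [al]. *)
have [w /homP wE] : exists w, hom_pre (hom_pre al I) E w = w0.
  apply/((dual_exactP _ _).1 (hom_pre_exact (V := I) ab bs)).
  apply/homP => h; rewrite -[LHS]/(w0 (hom_pre be I h)) w0E.
  by rewrite (tensor_map_comp (f := be) (g := h)) // tE t0.
have coordl k (i : 'I_k) (x : I) : linear (fun v : 'rV[R]_k => v 0 i *: x).
  by move=> a v v'; rewrite !mxE scalerDl scalerA.
have wl (i : 'I_m) : linear (fun x => w (mk_linear (coordl _ i x)) : E).
  move=> a x y; rewrite -linearP; congr (w _); apply/homP => v /=.
  by rewrite scalerDr !scalerA mulrC.
(* Functionals on Hom(R^m, I) are the elements of F (x) R^m; [v] is the one inducing [w]. *)
pose v := \sum_i tpure (mk_linear (wl i) : F) (delta_mx 0 i : 'rV[R]_m).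
have vE (h : hom 'rV[R]_m I) : ev (tensor_map F h v) = w h.
  rewrite evsum /= -linear_sum; congr (w _); apply/homP => x.
  rewrite [x in RHS]row_sum_delta linear_sum.
  transitivity (\sum_i x 0 i *: h (delta_mx 0 i)).
    pose ex (g : hom 'rV[R]_m I) := g x.
    have exl : linear ex by [].
    by rewrite -[LHS]/(mk_linear exl _) linear_sum.
  by apply: eq_bigr => i _; rewrite linearZ.
have [psi dE] := tensor_row_sum (u - tensor_map F al v).
(* The coordinates of [u] minus the image of [v] are detected by the maps sending one basis vector
   to [x] and the others to 0. So [u] comes from [v], and its image [t] is zero. *)
have psi0 i : psi i = 0.
  apply/homP => x; rewrite hom0E.
  have : ev (tensor_map F (mk_linear (coordl _ i x)) (u - tensor_map F al v)) = 0.
    set h := mk_linear _; rewrite !linearB /= -w0E -wE.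
    rewrite -(tensor_map_comp (h := hom_pre al I h)) // vE.
    exact: subrr.
  rewrite dE evsum (bigD1 i) //= big1 ?addr0 => [|k ki].
    by rewrite mxE !eqxx scale1r.
  by rewrite mxE (eq_sym i) (negPf ki) andbF scale0r linear0.
rewrite -tE; have -> : u = tensor_map F al v.
  apply/subr0_eq; rewrite dE big1 // => i _; rewrite psi0.
  exact: tpure0l.
by apply: exact_comp0; apply: (tensor_map_exact (M := F) ab bs).
Qed.

Hypothesis hR : coherent R.

(** An element of the tensor product comes from a finitely generated subideal, which is finitely
    presented by coherence, so [fp_tensor_inj] applies to it. *)
Lemma ideal_tensor_inj A (j : {linear A -> R^o}) :
  injective j -> injective (tensor_map F j).
Proof.
move=> ji; apply: inj_linear => t.
have [n [g [u ->]]] := tensor_fg t.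
pose io := sub_incl (im_sub g).
have [|g' g'E] := @factor_inj _ _ _ _ io g (@sub_incl_inj _ _ _).
  by move=> x; apply/sub_inclP; exists x.
have g's : surjective g'.
  move=> y; have /sub_inclP[x xE] : exists z, io z = io y by exists y.
  by exists x; apply: (@sub_incl_inj _ _ (im_sub g)); rewrite g'E.
rewrite (tensor_map_comp (f := g') (g := io)) //.
have jil : linear (j \o io) by move=> a x y; rewrite /= !linearP.
pose ji' : {linear _ -> R^o} := mk_linear jil.
have ji'i : injective ji' by move=> x y /ji/sub_incl_inj.
move=> jt; have {}jt : tensor_map F ji' (tensor_map F g' u) = 0.
  by rewrite (tensor_map_comp (f := io) (g := j)).
have bfp : finitely_presented (subm (im_sub g)).
  by apply: hR ji'i _; exists n, g'.
have -> : tensor_map F g' u = 0; last by rewrite linear0.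
by apply: (fp_tensor_inj bfp ji'i); rewrite jt linear0.
Qed.

(** Baer's criterion for F^+. The first projection embeds a graph [G] into [R] as an ideal, and
    extending the second projection along it means, by adjunction, extending a functional from F (x)
    G to F (x) R. *)
Lemma dual_injective_flat : flat F.
Proof.
apply/flat_dualP/baer_injective => G Gf.
have fl : linear (fun p : subm G => (sub_incl G p).1 : R^o).
  by move=> a x y; rewrite linearP.
have sl : linear (fun p : subm G => (sub_incl G p).2).
  by move=> a x y; rewrite linearP.
have fi : injective (mk_linear fl).
  move=> p q pq; apply: sub_incl_inj.
  have Gp : G (sub_incl G p) by apply/sub_inclP; exists p.
  have Gq : G (sub_incl G q) by apply/sub_inclP; exists q.
  have {}pq : (sub_incl G p).1 = (sub_incl G q).1 := pq.
  case: (sub_incl G p) (sub_incl G q) pq Gp Gq => [a x] [b y] /= -> Gx Gy.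
  by rewrite (functional_eq Gf Gx Gy).
have [l lE] := curryr_surj (mk_linear sl : hom (subm G) (hom F E)).
have [k kE] := (dual_injP _).1 (ideal_tensor_inj fi) l.
exists (curryr k 1) => a x Gax.
have -> : a *: curryr k 1 = curryr k a.
  by rewrite -linearZ; congr (curryr k _); apply: mulr1.
have [p pE] : exists p, sub_incl G p = (a, x) by apply/sub_inclP.
have kp : curryr k (sub_incl G p).1 = (sub_incl G p).2.
  have /homP : hom_pre (mk_linear fl) (hom F E) (curryr k) = mk_linear sl.
    by rewrite curryr_natural kE.
  exact.
by rewrite pE in kp.
Qed.
End DualOfInjective.
End FlatModules.

(** * Complete resolutions spliced from short exact sequences *)

Section Splicing.
Variable R : comPzRingType.
Implicit Types A B C J K M N : lmodType R.

Lemma in_image (A B : Type) (f : A -> B) x : exists x', f x' = f x.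
Proof. by exists x. Qed.

Lemma exact_splice (A B C S S' : zmodType) (u : A -> B) (v : B -> C)
    (g : A -> S) (f : S -> B) (g' : B -> S') (f' : S' -> C) :
    (forall x, u x = f (g x)) -> (forall y, v y = f' (g' y)) ->
    surjective g -> exact f g' -> injective f' -> f' 0 = 0 ->
  exact u v.
Proof.
move=> uE vE gs fg' f'i f'0 y.
have vP : v y = 0 <-> g' y = 0 by rewrite vE -f'0; split=> [/f'i|->].
apply: iff_trans vP _; apply: iff_trans (fg' y) _.
split=> [[s <-]|[x <-]]; last by exists (g x); rewrite uE.
by have [x <-] := gs s; exists x; rewrite uE.
Qed.

Variables (Q : lmodType R -> Prop)
  (T : forall A B C, {linear A -> B} -> {linear B -> C} -> Prop).

(** [Q] restricts the middle term and [T] adds an exactness test; they are instantiated below by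
    flat modules with [tensor_test] and by injective modules with [hom_test]. *)
Record extension K M := Extension {
  ext_mid : lmodType R;
  ext_in : {linear K -> ext_mid};
  ext_out : {linear ext_mid -> M};
  ext_midP : Q ext_mid;
  ext_exact : short_exact ext_in ext_out;
  ext_test : T ext_in ext_out
}.

(** A local stand-in for complete resolutions: extensions inside [G] can be chosen one after the
    other in both directions and spliced, so that only single short exact sequences need to be
    constructed. *)
Definition two_sided (G : lmodType R -> Prop) : Prop :=
  forall M, G M -> (exists2 K, G K & inhabited (extension K M)) /\
                   (exists2 C, G C & inhabited (extension M C)).

Lemma two_sided_sequence (G : lmodType R -> Prop) M : two_sided G -> G M ->
  exists s : int -> lmodType R,
    s 0 = M /\ forall i, inhabited (extension (s (i + 1)) (s i)).
Proof.
move=> GP GM; pose St := {N | G N}.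
have /choice[dn dnP] : forall N : St, exists K : St,
    inhabited (extension (sval K) (sval N)).
  by move=> [N GN]; have [[K GK KN] _] := GP N GN; exists (exist _ K GK).
have /choice[up upP] : forall N : St, exists C : St,
    inhabited (extension (sval N) (sval C)).
  by move=> [N GN]; have [_ [C GC NC]] := GP N GN; exists (exist _ C GC).
pose M0 : St := exist _ M GM.
(* Syzygies sit at positive indices and cosyzygies at negative ones; [Negz n] stands for -(n + 1),
   hence [n.+1] steps up. *)
pose s (i : int) : lmodType R := sval match i with
  | Posz n => iter n dn M0 | Negz n => iter n.+1 up M0 end.
exists s; split=> // -[n|[|n]].
- by rewrite -PoszD addn1; apply: dnP.
- exact: upP.
- have -> : Negz n.+1 + 1 = Negz n.
    by rewrite !NegzE (intS n.+1) opprD addrAC addNr add0r.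
  exact: upP.
Qed.

Lemma two_sided_complex (G : lmodType R -> Prop) M : two_sided G -> G M ->
  exists C : complex R, [/\ forall i, Q (C i), exact_complex C, is_syzygy M C &
    exists (s : int -> lmodType R) (f : forall i, {linear s (i + 1) -> C i})
      (g : forall i, {linear C i -> s i}),
    forall i, T (f i) (g i) /\ forall x, cx_diff C i x = f i (g (i + 1) x)].
Proof.
move=> GP GM; have [s [s0 sP]] := two_sided_sequence GP GM.
case: _ / s0; pose e i := inhabited_witness (sP i).
(* The differential passes through [s (i + 1)], so the one of index -1 has image [s 0], which is
   [M]. *)
pose d i : {linear ext_mid (e (i + 1)) -> ext_mid (e i)} :=
  GRing.Linear.clone _ _ _ _ (ext_in (e i) \o ext_out (e (i + 1))) _.
exists (Complex d); split=> [i|i||].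
- exact: ext_midP.
- have [_ _ gs] := ext_exact (e (i + 1 + 1)).
  have [_ fg _] := ext_exact (e (i + 1)).
  have [fi _ _] := ext_exact (e i).
  by apply: (exact_splice _ _ gs fg fi) => //; apply: linear0.
- have [fi _ _] := ext_exact (e (-1)).
  have [_ _ gs] := ext_exact (e 0).
  exists (ext_in (e (-1))); split=> // y; split=> [[x <-]|[x <-]].
    by have [z <-] := gs x; exists z.
  by exists (ext_out (e 0) x).
- exists s, (fun i => ext_in (e i)), (fun i => ext_out (e i)) => i.
  by split=> //; apply: ext_test.
Qed.

Lemma iso_image_incl A B (f : {linear A -> B}) : iso_image (subm (im_sub f)) f.
Proof.
exists (sub_incl (im_sub f)); split; first exact: sub_incl_inj.
exact: sub_inclP.
Qed.

Lemma complex_link (P : complex R) i K N (e : {linear N -> P i})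
    (e' : {linear K -> P (i + 1)}) : exact_complex P ->
    injective e -> (forall y, (exists x, e x = y) <-> (exists x, cx_diff P i x = y)) ->
    injective e' ->
    (forall y, (exists x, e' x = y) <-> (exists x, cx_diff P (i + 1) x = y)) ->
  exists g : {linear P (i + 1) -> N},
    (forall x, e (g x) = cx_diff P i x) /\ short_exact e' g.
Proof.
move=> Pe ei eP e'i e'P.
have [x|g gE] := @factor_inj _ _ _ _ e (cx_diff P i) ei.
  by apply/eP; exists x.
exists g; split=> //; split=> // [y|n].
  apply: iff_trans (iff_sym (e'P y)); apply: iff_trans (Pe i y).
  by rewrite -gE; split=> [->|gy]; [apply: linear0 | apply: ei; rewrite gy linear0].
by have /eP[x xE] := in_image e n; exists x; apply: ei; rewrite gE.
Qed.

(** The class consists of the images of all differentials. The test is stated at [i + 1] so that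
    [cx_diff P i], the next differential, is available without transport; [link] recovers every
    index from this. *)
Lemma complex_two_sided (P : complex R) : exact_complex P ->
    (forall i, Q (P i)) ->
    (forall i K N (e : {linear N -> P (i + 1)}) (e' : {linear K -> P (i + 1 + 1)})
        (g : {linear P (i + 1 + 1) -> N}),
      injective e ->
      (forall y, (exists x, e x = y) <-> (exists x, cx_diff P (i + 1) x = y)) ->
      (forall y, (exists x, e' x = y) <-> (exists x, cx_diff P (i + 1 + 1) x = y)) ->
      (forall x, e (g x) = cx_diff P (i + 1) x) -> short_exact e' g -> T e' g) ->
  two_sided (fun N => exists i, iso_image N (cx_diff P i)).
Proof.
move=> Pe PQ PT.
have link i K N : iso_image N (cx_diff P i) -> iso_image K (cx_diff P (i + 1)) ->
    inhabited (extension K N).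
  suff H k : iso_image N (cx_diff P (k + 1)) ->
      iso_image K (cx_diff P (k + 1 + 1)) -> inhabited (extension K N).
    by have := H (i - 1); rewrite subrK.
  move=> [e [ei eP]] [e' [e'i e'P]].
  have [g [gE e'g]] := complex_link Pe ei eP e'i e'P.
  by split; exists (P (k + 1 + 1)) e' g => //; apply: (PT k _ _ e).
move=> N [i NI]; split.
  exists (subm (im_sub (cx_diff P (i + 1)))).
    by exists (i + 1); apply: iso_image_incl.
  by apply: link NI _; apply: iso_image_incl.
exists (subm (im_sub (cx_diff P (i - 1)))).
  by exists (i - 1); apply: iso_image_incl.
by apply: link (iso_image_incl _) _; rewrite subrK.
Qed.
End Splicing.

(** * Gorenstein flat and Gorenstein injective modules through two-sided classes *)

Section GorensteinClasses.
Variable R : comPzRingType.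
Implicit Types A B C J K M N : lmodType R.

Definition tensor_test A B C (f : {linear A -> B}) (g : {linear B -> C}) : Prop :=
  forall J, injective_module J -> short_exact (tensor_map J f) (tensor_map J g).

Definition hom_test A B C (f : {linear A -> B}) (g : {linear B -> C}) : Prop :=
  forall J, injective_module J -> short_exact (hom_post J f) (hom_post J g).

Definition flat_ext := extension (@flat R) tensor_test.
Definition inj_ext := extension (@injective_module R) hom_test.

Lemma Gorenstein_flatP M : Gorenstein_flat M <->
  exists2 G, two_sided (@flat R) tensor_test G & G M.
Proof.
split=> [[P [Pf Pe PJ MP]]|[G GP GM]]; last first.
  have [C [Cf Ce MC [s [f [g fgP]]]]] := two_sided_complex GP GM.
  exists C; split=> // J Ji i.
  have [_ _ gs] := (fgP (i + 1 + 1)).1 J Ji.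
  have [_ fg _] := (fgP (i + 1)).1 J Ji.
  have [fi _ _] := (fgP i).1 J Ji.
  apply: (exact_splice _ _ gs fg fi); last exact: linear0.
    by apply: tensor_map_comp; apply: (fgP _).2.
  by apply: tensor_map_comp; apply: (fgP _).2.
exists (fun N => exists i, iso_image N (cx_diff P i)); last by exists (-1).
apply: complex_two_sided => // i K N e e' g ei eP e'P gE [e'i eg gs] J Ji.
split; [|exact: tensor_map_exact|exact: tensor_map_surj].
(* Lift [z] to [w] in the preceding term of the complex. Exactness of the complex tensored with [J]
   makes [w] a boundary, and [g'] kills boundaries. *)
apply: inj_linear => z e'z.
have [x|g' g'E] := @factor_inj _ _ _ _ e' (cx_diff P (i + 1 + 1)) e'i.
  by apply/e'P; exists x.
have g's : surjective g'.
  move=> n; have /e'P[x xE] := in_image e' n.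
  by exists x; apply: e'i; rewrite g'E.
have [w wz] := tensor_map_surj (M := J) g's z.
have /PJ[//|v vw] : tensor_map J (cx_diff P (i + 1 + 1)) w = 0.
  by rewrite (tensor_map_comp (f := g') (g := e')) ?wz.
rewrite -wz -vw -(tensor_map_comp (h := \0)); first exact: tensor_map0.
move=> x; apply: e'i; rewrite g'E linear0.
by apply/esym; apply: exact_comp0 (Pe _) x.
Qed.

Lemma Gorenstein_injectiveP M : Gorenstein_injective M <->
  exists2 G, two_sided (@injective_module R) hom_test G & G M.
Proof.
split=> [[P [Pi Pe PJ MP]]|[G GP GM]]; last first.
  have [C [Ci Ce MC [s [f [g fgP]]]]] := two_sided_complex GP GM.
  exists C; split=> // J Ji i.
  have [_ _ gs] := (fgP (i + 1 + 1)).1 J Ji.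
  have [_ fg _] := (fgP (i + 1)).1 J Ji.
  have [fi _ _] := (fgP i).1 J Ji.
  apply: (exact_splice _ _ gs fg fi); last exact: linear0.
    by move=> h; apply/homP => x; apply: (fgP _).2.
  by move=> h; apply/homP => x; apply: (fgP _).2.
exists (fun N => exists i, iso_image N (cx_diff P i)); last by exists (-1).
apply: complex_two_sided => // i K N e e' g ei eP e'P gE e'g J Ji.
apply: short_exact_hom_post => // h.
(* The image of [e] is that of a differential, so the next differential kills [e] after [h], and
   exactness of Hom(J, P) lifts this composite to [w]. *)
have /PJ[//|w /homP wE] : hom_post J (cx_diff P i) (hom_post J e h) = 0.
  apply/homP => x /=; have /eP[y <-] := in_image e (h x).
  exact: exact_comp0 (Pe i) y.
by exists w; apply/homP => x; apply: ei; rewrite gE; apply: wE.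
Qed.
End GorensteinClasses.

(** * Products, lifting and retracts for Gorenstein injective modules *)

Section GorensteinInjective.
Variable R : comPzRingType.
Implicit Types A B C D I J K L M N Q : lmodType R.

Local Notation E := (charmod R).

Definition pair_map A B C (f : {linear A -> B}) (g : {linear A -> C}) :
    {linear A -> (B * C)%type}.
Proof.
refine (@mk_linear _ A (B * C)%type (fun x => (f x, g x)) _).
by move=> a x y; rewrite !linearP.
Defined.

Definition sum_map A B C (f : {linear A -> C}) (g : {linear B -> C}) :
    {linear (A * B)%type -> C}.
Proof.
refine (@mk_linear _ (A * B)%type C (fun x => f x.1 + g x.2) _).
by move=> a x y; rewrite /= !linearP scalerDr addrACA.
Defined.

Definition prod_map A B C D (f : {linear A -> B}) (g : {linear C -> D}) :
    {linear (A * C)%type -> (B * D)%type}.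
Proof.
refine (@mk_linear _ (A * C)%type (B * D)%type (fun x => (f x.1, g x.2)) _).
by move=> a x y; rewrite /= !linearP.
Defined.

Lemma injective_module_prod I Q :
  injective_module I -> injective_module Q -> injective_module (I * Q)%type.
Proof.
move=> Ii Qi A B f fi h.
have hl1 : linear (fun x => (h x).1) by move=> a x y; rewrite linearP.
have hl2 : linear (fun x => (h x).2) by move=> a x y; rewrite linearP.
have [k1 /homP k1E] := Ii _ _ f fi (mk_linear hl1).
have [k2 /homP k2E] := Qi _ _ f fi (mk_linear hl2).
exists (pair_map k1 k2); apply/homP => x /=.
have -> : k1 (f x) = (h x).1 := k1E x.
have -> : k2 (f x) = (h x).2 := k2E x.
by case: (h x).
Qed.

Lemma Gorenstein_injective_two_sided :
  two_sided (@injective_module R) (@hom_test R) (@Gorenstein_injective R).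
Proof.
move=> M /Gorenstein_injectiveP[G GP GM]; have [[K GK KM] [C GC MC]] := GP M GM.
by split; [exists K|exists C] => //; apply/Gorenstein_injectiveP; exists G.
Qed.

(** Direct sum with the trivial extension 0 -> Q -> Q. *)
Lemma inj_ext_prodr K L Q :
  injective_module Q -> inj_ext K L -> inj_ext K (L * Q)%type.
Proof.
move=> Qi [I f g Ii fg T]; have [fi efg gs] := fg.
pose f' := pair_map f (\0 : {linear K -> Q}).
pose g' := prod_map g (idfun : {linear Q -> Q}).
have fg' : short_exact f' g'.
  split=> [x y [/fi]|[y z]|[l z]] //=; last first.
    by have [y <-] := gs l; exists (y, z).
  suff : (g y, z) = 0 :> L * Q <-> exists x, f' x = (y, z) by [].
  split=> [[/efg[x <-] ->]|[x [<- <-]]]; first by exists x.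
  by rewrite (exact_comp0 efg).
exists _ f' g' => //; first exact: injective_module_prod.
move=> J Ji; apply: short_exact_hom_post => // h.
have hl1 : linear (fun x => (h x).1) by move=> a x y; rewrite linearP.
have hl2 : linear (fun x => (h x).2) by move=> a x y; rewrite linearP.
have [_ _ gJs] := T J Ji; have [k /homP kE] := gJs (mk_linear hl1).
exists (pair_map k (mk_linear hl2)); apply/homP => x /=.
by have -> : g (k x) = (h x).1 := kE x; case: (h x).
Qed.

(** Direct sum with the trivial extension Q -> Q -> 0. *)
Lemma inj_ext_prodl L C Q :
  injective_module Q -> inj_ext L C -> inj_ext (L * Q)%type C.
Proof.
move=> Qi [I f g Ii fg T]; have [fi efg gs] := fg.
pose f' := prod_map f (idfun : {linear Q -> Q}).
pose g' := sum_map g (\0 : {linear Q -> C}).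
have g'E x : g' x = g x.1 by rewrite /= addr0.
have fg' : short_exact f' g'.
  split=> [[x z] [y w] [/fi -> ->]|[y z]|c] //; last first.
    by have [y <-] := gs c; exists (y, 0); rewrite g'E.
  apply: iff_trans (_ : g y = 0 <-> _); first by rewrite -[y]/(y, z).1 -g'E.
  split=> [/efg[x <-]|[[x w] [<- _]]]; first by exists (x, z).
  by rewrite (exact_comp0 efg).
exists _ f' g' => //; first exact: injective_module_prod.
move=> J Ji; apply: short_exact_hom_post => // h.
have [_ _ gJs] := T J Ji; have [k /homP kE] := gJs h.
by exists (pair_map k \0); apply/homP => x; rewrite [LHS]g'E; apply: kE.
Qed.

(** Adjoining all [L * Q] to the Gorenstein injective modules keeps the class two-sided, since a
    syzygy and a cosyzygy of [L] also serve for [L * Q]. *)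
Lemma Gorenstein_injective_prod N Q :
  Gorenstein_injective N -> injective_module Q ->
  Gorenstein_injective (N * Q)%type.
Proof.
move=> NG Qi; apply/Gorenstein_injectiveP.
exists (fun X => Gorenstein_injective X \/
  exists2 L, Gorenstein_injective L & X = (L * Q)%type :> lmodType R); last first.
  by right; exists N.
move=> X [XG|[L GL ->]].
  have [[K GK KX] [C GC XC]] := Gorenstein_injective_two_sided XG.
  by split; [exists K|exists C] => //; left.
have [[K GK [KL]] [C GC [LC]]] := Gorenstein_injective_two_sided GL.
split; [exists K|exists C]; try by left.
- by split; apply: inj_ext_prodr.
- by split; apply: inj_ext_prodl.
Qed.

(** This is the vanishing of Ext^1(J, N). Embedding [N] into [I] with cokernel [L] presents [B] as
    the pullback of [I] and [C] over [L], and maps from [J] to [L] lift to [I]. *)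
Lemma Gorenstein_injective_lift N B C J (f : {linear N -> B})
    (g : {linear B -> C}) :
  Gorenstein_injective N -> short_exact f g -> injective_module J ->
  surjective (hom_post J g).
Proof.
move=> /Gorenstein_injective_two_sided[_ [L _ [[I u p Ii [ui up ps] T]]]].
move=> [fi fg gs] Ji h.
have [w /homP wE] := Ii _ _ f fi u.
have wfE n : w (f n) = u n by apply: wE.
have pwl : linear (p \o w) by move=> a x y; rewrite /= !linearP.
have [|t tE] := @factor_surj _ _ _ _ g (mk_linear pwl) gs.
  by move=> y /fg[n <-]; rewrite /= wfE (exact_comp0 up).
have thl : linear (t \o h) by move=> a x y; rewrite /= !linearP.
have [_ _ pJs] := T J Ji; have [v /homP vE] := pJs (mk_linear thl).
(* [(g, w)] embeds [B] as the pullback of [t] and [p]; the pair [(h, v)] takes its values there and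
   therefore factors through [B]. *)
have [|j|k kE] := @factor_inj _ _ _ _ (pair_map g w) (pair_map h v).
- apply: inj_linear => y [/fg[n <-]]; rewrite wfE -[0](linear0 u) => /ui ->.
  exact: linear0.
- have [b bE] := gs (h j).
  have /up[n nE] : p (w b - v j) = 0.
    rewrite linearB /= -[p (w b)]tE bE.
    by apply/eqP; rewrite subr_eq0; apply/eqP/esym/vE.
  exists (b - f n); rewrite /= !linearB /= wfE nE bE (exact_comp0 fg) subr0.
  by rewrite opprB addrC subrK.
- by exists k; apply/homP => j; have [] := kE j.
Qed.

(* Schanuel: comparison maps [a], [b] between two injective coresolutions of
   [N] make [1 - b a] factor through the cokernel. *)
Lemma injective_cosyzygy_retract N I L I' L' (u : {linear N -> I})
    (p : {linear I -> L}) (u' : {linear N -> I'}) (p' : {linear I' -> L'}) :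
    injective_module I -> injective_module I' ->
    short_exact u p -> short_exact u' p' ->
  exists (s : {linear L' -> (L * I')%type}) (r : {linear (L * I')%type -> L'}),
    forall x, r (s x) = x.
Proof.
move=> Ii I'i [ui up ps] [u'i up' p's].
have [a /homP aE] := Ii _ _ u' u'i u; have {}aE n : a (u' n) = u n := aE n.
have [b /homP bE] := I'i _ _ u ui u'; have {}bE n : b (u n) = u' n := bE n.
have dl : linear (fun x => x - b (a x)).
  by move=> c x y; rewrite (linearP a) (linearP b) scalerBr opprD addrACA.
have [|c cE] := @factor_surj _ _ _ _ p' (mk_linear dl) p's.
  by move=> _ /up'[n <-]; rewrite /= aE bE subrr.
have pal : linear (p \o a) by move=> d x y; rewrite /= !linearP.
have [|a' a'E] := @factor_surj _ _ _ _ p' (mk_linear pal) p's.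
  by move=> _ /up'[n <-]; rewrite /= aE (exact_comp0 up).
have pbl : linear (p' \o b) by move=> d x y; rewrite /= !linearP.
have [|b' b'E] := @factor_surj _ _ _ _ p (mk_linear pbl) ps.
  by move=> _ /up[n <-]; rewrite /= bE (exact_comp0 up').
exists (pair_map a' c), (sum_map b' p') => z; have [x <-] := p's z.
rewrite /= a'E cE /= b'E linearB /=.
by rewrite addrC subrK.
Qed.

(** The dual Schanuel argument: the two lifting hypotheses supply comparison maps [a] and [b] over
    [M], and [1 - b a] takes its values in the kernel [K']. *)
Lemma injective_syzygy_retract M I K I' K' (k : {linear K -> I})
    (p : {linear I -> M}) (k' : {linear K' -> I'}) (p' : {linear I' -> M}) :
    surjective (hom_post I' p) -> surjective (hom_post I p') ->
    short_exact k p -> short_exact k' p' ->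
  exists (s : {linear K' -> (K * I')%type}) (r : {linear (K * I')%type -> K'}),
    forall x, r (s x) = x.
Proof.
move=> pl p'l [ki kp _] [k'i kp' _].
have [a /homP aE] := pl p'; have {}aE x : p (a x) = p' x := aE x.
have [b /homP bE] := p'l p; have {}bE x : p' (b x) = p x := bE x.
have dl : linear (fun x => x - b (a x)).
  by move=> c x y; rewrite (linearP a) (linearP b) scalerBr opprD addrACA.
have [x|c cE] := @factor_inj _ _ _ _ k' (mk_linear dl) k'i.
  by apply/kp'; rewrite /= linearB /= bE aE subrr.
have akl : linear (a \o k') by move=> d x y; rewrite /= !linearP.
have [x|a' a'E] := @factor_inj _ _ _ _ k (mk_linear akl) ki.
  by apply/kp; rewrite /= aE (exact_comp0 kp').
have bkl : linear (b \o k) by move=> d x y; rewrite /= !linearP.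
have [x|b' b'E] := @factor_inj _ _ _ _ k' (mk_linear bkl) k'i.
  by apply/kp'; rewrite /= bE (exact_comp0 kp).
exists (pair_map a' k'), (sum_map b' c) => x; apply: k'i.
by rewrite /= linearD /= b'E cE /= a'E addrC subrK.
Qed.

Lemma pure_injective_retract (X : lmodType R -> Prop) N N'
    (s : {linear N' -> N}) (r : {linear N -> N'}) :
  (forall x, r (s x) = x) -> pure_injective X N -> pure_injective X N'.
Proof.
move=> rs NX A B C f g fg; have [fgE _] := fg.
apply: short_exact_hom_pre => // h.
have [_ _ fs] := NX _ _ _ _ _ fg; have [k /homP kE] := fs (hom_post A s h).
exists (hom_post B r k); apply/homP => x.
by rewrite -[RHS]rs; congr (r _); apply: kE.
Qed.

(** * Gorenstein flatness of a module and Gorenstein injectivity of its dual *)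

Lemma dual_ext K M : flat_ext K M -> inj_ext (hom M E) (hom K E).
Proof.
move=> [F f g Ff fg T].
exists (hom F E) (hom_pre g E) (hom_pre f E); first exact/flat_dualP.
  exact: (dual_short_exactP f g).1.
by move=> J Ji; apply: (short_exact_tensor_post J f g).1; apply: T.
Qed.

Lemma Gorenstein_flat_dual M :
  Gorenstein_flat M -> Gorenstein_injective (hom M E).
Proof.
move=> /Gorenstein_flatP[G GP GM]; apply/Gorenstein_injectiveP.
(* Duals of the members of [G]: dualizing exchanges syzygies and cosyzygies. *)
exists (fun X => exists2 L, G L & X = hom L E :> lmodType R); last by exists M.
move=> X [L GL ->]; have [[K GK [KL]] [C GC [LC]]] := GP L GL.
split; [exists (hom C E)|exists (hom K E)].
- by exists C.
- by split; apply: dual_ext.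
- by exists K.
- by split; apply: dual_ext.
Qed.

Section GorensteinFlat.
Hypothesis hR : coherent R.
Hypothesis hGP : forall M,
  pure_injective (@Gorenstein_projective R) M <-> Gorenstein_injective M.

(** Closure under retracts is immediate for pure injectivity, and [hGP] carries it over. *)
Lemma Gorenstein_injective_retract N N' (s : {linear N' -> N})
    (r : {linear N -> N'}) :
  (forall x, r (s x) = x) -> Gorenstein_injective N -> Gorenstein_injective N'.
Proof. by move=> rs /hGP NX; apply/hGP; apply: pure_injective_retract rs NX. Qed.

Lemma dual_Gorenstein_injective_syzygy M : Gorenstein_injective (hom M E) ->
  exists2 K, Gorenstein_injective (hom K E) & inhabited (flat_ext K M).
Proof.
move=> MG; pose g := free_lift (id : M -> M).
have fg : short_exact (sub_incl (ker_sub g)) g.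
  exact/short_exact_ker/free_lift_id_surj.
have fgd := (dual_short_exactP _ _).1 fg.
have Ff : flat (free R M) by apply: free_flat.
exists (subm (ker_sub g)).
  (* Both [I] and the dual of the free cover are injective modules containing M^+; comparing their
     cokernels makes K^+ a retract of [L] times an injective module. *)
  have [_ [L GL [[I u p Ii up _]]]] := Gorenstein_injective_two_sided MG.
  have FEi : injective_module (hom (free R M) E) by apply/flat_dualP.
  have [s [r rs]] := injective_cosyzygy_retract Ii FEi up fgd.
  by apply: Gorenstein_injective_retract rs _; apply: Gorenstein_injective_prod.
split; exists _ (sub_incl (ker_sub g)) g => // J Ji.
apply/short_exact_tensor_post/short_exact_hom_post => //.
exact: Gorenstein_injective_lift MG fgd Ji.
Qed.

Lemma dual_Gorenstein_injective_cosyzygy M : Gorenstein_injective (hom M E) ->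
  exists2 C, Gorenstein_injective (hom C E) & inhabited (flat_ext M C).
Proof.
move=> MG; have [[K GK [[I k p Ii kp T]] _]] := Gorenstein_injective_two_sided MG.
pose F : lmodType R := hom I E.
(* [phi] is adjoint to [p]: it is the evaluation M -> M^++ followed by the dual of [p]. It is
   injective because [p] is onto and [E] separates points. *)
have phil1 m : linear (fun x => p x m : E) by move=> a x y; rewrite linearP.
have phil : linear (fun m => mk_linear (phil1 m) : hom I E).
  by move=> a x y; apply/homP => z /=; rewrite linearP.
pose phi : {linear M -> F} := mk_linear phil.
have phii : injective phi.
  apply: inj_linear => m /homP phi0; apply: dual_separates => f.
  by have [_ _ /(_ f)[x <-]] := kp; apply: phi0.
have Ff : flat F by apply: dual_injective_flat.
have FEi : injective_module (hom F E) by apply/flat_dualP.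
have fg := short_exact_coker phii.
have fgd := (dual_short_exactP _ _).1 fg.
have evl1 x : linear (fun f : hom I E => f x) by [].
have evl : linear (fun x => mk_linear (evl1 x) : hom F E).
  by move=> a x y; apply/homP => f /=; rewrite linearP.
(* The dual of [phi] composed with the evaluation I -> I^++ is [p], so a lift through [p] yields a
   lift through the dual of [phi]. *)
have qs J : injective_module J -> surjective (hom_post J (hom_pre phi E)).
  move=> Ji h; have [_ _ ps] := T J Ji; have [l /homP lE] := ps h.
  exists (hom_post J (mk_linear evl) l); apply/homP => j; apply/homP => m.
  by rewrite -[RHS]/((h j : hom M E) m) -lE.
exists (quot (im_sub phi)).
  (* [I] and F^+ both cover M^+ and each lifts through the other's map, so C^+ is a retract of [K]
     times F^+. *)
  have [_ _ pl] := T _ FEi.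
  have [s [r rs]] := injective_syzygy_retract pl (qs I Ii) kp fgd.
  by apply: Gorenstein_injective_retract rs _; apply: Gorenstein_injective_prod.
split; exists _ phi (quot_proj (im_sub phi)) => // J Ji.
by apply/short_exact_tensor_post/short_exact_hom_post => //; apply: qs.
Qed.

Lemma dual_Gorenstein_injective_flat M :
  Gorenstein_injective (hom M E) -> Gorenstein_flat M.
Proof.
move=> MG; apply/Gorenstein_flatP.
exists (fun N => Gorenstein_injective (hom N E)) => // N NG; split.
  exact: dual_Gorenstein_injective_syzygy.
exact: dual_Gorenstein_injective_cosyzygy.
Qed.
End GorensteinFlat.
End GorensteinInjective.

Theorem corollary3p2 (R : comPzRingType) (hR : coherent R)
    (hGP : forall M : lmodType R,
       pure_injective (@Gorenstein_projective R) M <-> Gorenstein_injective M) :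
  forall M : lmodType R,
    pure_flat (@Gorenstein_projective R) M <-> Gorenstein_flat M.
Proof.
move=> M; apply: iff_trans (pure_flatP _ _) _; apply: iff_trans (hGP _) _.
split; first exact: dual_Gorenstein_injective_flat.
exact: Gorenstein_flat_dual.
Qed.
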